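(* Let $G$ be a finite group scheme over a field $k$ of characteristic $p>0$ and let $M,N$ be finite dimensional $kG$-modules. If $M$ and $N$ have constant Jordan type, then $M\otimes N$ also has constant Jordan type.
   Context: $k$ is a field of characteristic $p>0$. A finite group scheme $G$ over $k$ is a group scheme whose coordinate algebra $k[G]$ is finite dimensional; its group algebra $kG$ (a Hopf algebra) is the linear dual of $k[G]$. $M\otimes N=M\otimes_k N$ with $kG$ acting through its coproduct. For a field extension $K/k$, $KG=K\otimes_k kG$ is the group algebra of $G_K=G\times_{\mathrm{Spec}\,k}\mathrm{Spec}\,K$, and $M_K=K\otimes_k M$. A $\pi$-point of $G$ is a left flat map of $K$-algebras $\alpha_K:K[t]/t^p\to KG$, for some field extension $K/k$, which factors through the group algebra $KC_K\subset KG$ of some unipotent abelian subgroup scheme $C_K\subset G_K$; $\alpha_K^*$ denotes restriction of modules along $\alpha_K$. Every finite dimensional $K[t]/t^p$-module is a direct sum of $a_i$ copies of the indecomposables $[i]=K[t]/t^i$, $1\le i\le p$; its Jordan type is written $a_p[p]+\cdots+a_1[1]$. A finite dimensional $kG$-module $M$ has constant Jordan type if the Jordan type of $\alpha_K^*(M_K)$ is the same for all $\pi$-points $\alpha_K$ of $G$. *)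

(* Defs.v *)
From HB Require Import structures.
From mathcomp Require Import all_boot all_order all_algebra.
From mathcomp Require Import mxtens.

Set Implicit Arguments.
Unset Strict Implicit.
Unset Printing Implicit Defensive.

Import GRing.Theory.
Local Open Scope ring_scope.

(** A finite group scheme [G] over [k] is given by its coordinate algebra
    [k[G]], a finite dimensional commutative Hopf algebra, written in a
    [k]-basis [e_i]:
      [e_i e_j = \sum_l gs_mul i j l e_l],  [1 = \sum_i gs_one i e_i],
      [Delta e_l = \sum_i \sum_j gs_comul l i j (e_i (x) e_j)],
      [eps e_i = gs_counit i],  [S e_i = \sum_j gs_anti i j e_j]. *)
Record finGroupScheme (k : fieldType) := FinGroupScheme {
  gs_order : nat;
  gs_mul : 'I_gs_order -> 'I_gs_order -> 'I_gs_order -> k;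
  gs_one : 'I_gs_order -> k;
  gs_comul : 'I_gs_order -> 'I_gs_order -> 'I_gs_order -> k;
  gs_counit : 'I_gs_order -> k;
  gs_anti : 'I_gs_order -> 'I_gs_order -> k;
  gs_mulA : forall a b c s,
    \sum_r gs_mul a b r * gs_mul r c s = \sum_r gs_mul b c r * gs_mul a r s;
  gs_mulC : forall a b s, gs_mul a b s = gs_mul b a s;
  gs_mul1 : forall a s, \sum_r gs_one r * gs_mul r a s = (a == s)%:R;
  gs_comulA : forall l a b c,
    \sum_r gs_comul l r c * gs_comul r a b
    = \sum_r gs_comul l a r * gs_comul r b c;
  gs_counitl : forall l a,
    \sum_r gs_counit r * gs_comul l r a = (l == a)%:R;
  gs_counitr : forall l a,
    \sum_r gs_counit r * gs_comul l a r = (l == a)%:R;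
  gs_comulM : forall i j a b,
    \sum_l gs_mul i j l * gs_comul l a b
    = \sum_i1 \sum_i2 \sum_j1 \sum_j2
        gs_comul i i1 i2 * gs_comul j j1 j2
        * (gs_mul i1 j1 a * gs_mul i2 j2 b);
  gs_comul1 : forall a b,
    \sum_l gs_one l * gs_comul l a b = gs_one a * gs_one b;
  gs_counitM : forall i j,
    \sum_l gs_mul i j l * gs_counit l = gs_counit i * gs_counit j;
  gs_counit1 : \sum_l gs_one l * gs_counit l = 1;
  gs_antil : forall l s,
    \sum_a \sum_b \sum_c gs_comul l a b * gs_anti a c * gs_mul c b s
    = gs_counit l * gs_one s;
  gs_antir : forall l s,
    \sum_a \sum_b \sum_c gs_comul l a b * gs_anti b c * gs_mul a c s
    = gs_counit l * gs_one s
}.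

Arguments gs_mul {k} f.
Arguments gs_one {k} f.
Arguments gs_comul {k} f.
Arguments gs_counit {k} f.
Arguments gs_anti {k} f.

Section BaseChange.
Variables (k K : fieldType) (iota : {rmorphism k -> K}) (G : finGroupScheme k).

Let iota_eq (x y : k) : x = y -> iota x = iota y. Proof. by move->. Qed.

Let mul' a b c := iota (gs_mul G a b c).
Let one' a := iota (gs_one G a).
Let comul' a b c := iota (gs_comul G a b c).
Let counit' a := iota (gs_counit G a).
Let anti' a b := iota (gs_anti G a b).

Fact bc_mulA a b c s :
  \sum_r mul' a b r * mul' r c s = \sum_r mul' b c r * mul' a r s.
Proof.
have := iota_eq (gs_mulA a b c s); rewrite !rmorph_sum /= => E.
by under eq_bigr do rewrite -rmorphM; rewrite E; apply: eq_bigr => r _;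
  rewrite rmorphM.
Qed.

Fact bc_mulC a b s : mul' a b s = mul' b a s.
Proof. by rewrite /mul' gs_mulC. Qed.

Fact bc_mul1 a s : \sum_r one' r * mul' r a s = (a == s)%:R.
Proof.
have := iota_eq (gs_mul1 a s); rewrite rmorph_nat rmorph_sum /= => <-.
by apply: eq_bigr => r _; rewrite rmorphM.
Qed.

Fact bc_comulA l a b c :
  \sum_r comul' l r c * comul' r a b = \sum_r comul' l a r * comul' r b c.
Proof.
have := iota_eq (gs_comulA l a b c); rewrite !rmorph_sum /= => E.
by under eq_bigr do rewrite -rmorphM; rewrite E; apply: eq_bigr => r _;
  rewrite rmorphM.
Qed.

Fact bc_counitl l a : \sum_r counit' r * comul' l r a = (l == a)%:R.
Proof.
have := iota_eq (gs_counitl l a); rewrite rmorph_nat rmorph_sum /= => <-.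
by apply: eq_bigr => r _; rewrite rmorphM.
Qed.

Fact bc_counitr l a : \sum_r counit' r * comul' l a r = (l == a)%:R.
Proof.
have := iota_eq (gs_counitr l a); rewrite rmorph_nat rmorph_sum /= => <-.
by apply: eq_bigr => r _; rewrite rmorphM.
Qed.

Fact bc_comulM i j a b :
  \sum_l mul' i j l * comul' l a b
  = \sum_i1 \sum_i2 \sum_j1 \sum_j2
      comul' i i1 i2 * comul' j j1 j2 * (mul' i1 j1 a * mul' i2 j2 b).
Proof.
transitivity (iota (\sum_l gs_mul G i j l * gs_comul G l a b)).
  by rewrite rmorph_sum; apply: eq_bigr => l _; rewrite rmorphM.
rewrite gs_comulM rmorph_sum.
apply: eq_bigr => i1 _; rewrite rmorph_sum; apply: eq_bigr => i2 _.
rewrite rmorph_sum; apply: eq_bigr => j1 _; rewrite rmorph_sum.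
by apply: eq_bigr => j2 _; rewrite !rmorphM.
Qed.

Fact bc_comul1 a b : \sum_l one' l * comul' l a b = one' a * one' b.
Proof.
have := iota_eq (gs_comul1 a b); rewrite rmorphM rmorph_sum /= => <-.
by apply: eq_bigr => r _; rewrite rmorphM.
Qed.

Fact bc_counitM i j : \sum_l mul' i j l * counit' l = counit' i * counit' j.
Proof.
have := iota_eq (gs_counitM i j); rewrite rmorphM rmorph_sum /= => <-.
by apply: eq_bigr => r _; rewrite rmorphM.
Qed.

Fact bc_counit1 : \sum_l one' l * counit' l = 1.
Proof.
have := iota_eq (gs_counit1 G); rewrite rmorph1 rmorph_sum /= => <-.
by apply: eq_bigr => r _; rewrite rmorphM.
Qed.

Fact bc_antil l s :
  \sum_a \sum_b \sum_c comul' l a b * anti' a c * mul' c b s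
  = counit' l * one' s.
Proof.
rewrite -rmorphM -(gs_antil l s) rmorph_sum.
apply: eq_bigr => a _; rewrite rmorph_sum; apply: eq_bigr => b _.
by rewrite rmorph_sum; apply: eq_bigr => c _; rewrite !rmorphM.
Qed.

Fact bc_antir l s :
  \sum_a \sum_b \sum_c comul' l a b * anti' b c * mul' a c s
  = counit' l * one' s.
Proof.
rewrite -rmorphM -(gs_antir l s) rmorph_sum.
apply: eq_bigr => a _; rewrite rmorph_sum; apply: eq_bigr => b _.
by rewrite rmorph_sum; apply: eq_bigr => c _; rewrite !rmorphM.
Qed.

Definition base_change : finGroupScheme K :=
  FinGroupScheme bc_mulA bc_mulC bc_mul1 bc_comulA bc_counitl bc_counitr
    bc_comulM bc_comul1 bc_counitM bc_counit1 bc_antil bc_antir.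

End BaseChange.

(** The group algebra [kG], the linear dual of [k[G]]: the row vector [f]
    stands for the linear form sending [e_i] to [f 0 i]. *)
Definition grpalg (k : fieldType) (G : finGroupScheme k) : Type :=
  'rV[k]_(gs_order G).

Section GroupAlgebra.
Variables (k : fieldType) (G : finGroupScheme k).

HB.instance Definition _ := GRing.Lmodule.on (grpalg G).

(** [(f g)(e_l) = (f (x) g)(Delta e_l)] and [1 = eps]. *)
Definition grpalg_mul (f g : grpalg G) : grpalg G :=
  \row_l \sum_i \sum_j gs_comul G l i j * (f 0 i * g 0 j).

Definition grpalg_one : grpalg G := \row_l gs_counit G l.

Fact grpalg_mulA : associative grpalg_mul.
Proof.
move=> f g h; apply/rowP => l; rewrite !mxE.
transitivity (\sum_a \sum_b \sum_c (\sum_r gs_comul G l a r * gs_comul G r b c)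
    * (f 0 a * (g 0 b * h 0 c))).
  apply: eq_bigr => a _.
  transitivity (\sum_r \sum_b \sum_c gs_comul G l a r * gs_comul G r b c
      * (f 0 a * (g 0 b * h 0 c))).
    apply: eq_bigr => r _; rewrite mxE mulrA mulr_sumr.
    apply: eq_bigr => b _; rewrite mulr_sumr; apply: eq_bigr => c _.
    by rewrite -!mulrA; congr (_ * _); rewrite mulrCA.
  rewrite exchange_big; apply: eq_bigr => b _ /=.
  by rewrite exchange_big; apply: eq_bigr => c _ /=; rewrite mulr_suml.
transitivity (\sum_c \sum_r gs_comul G l r c *
   ((\sum_a \sum_b gs_comul G r a b * (f 0 a * g 0 b)) * h 0 c)); last first.
  rewrite exchange_big; apply: eq_bigr => r _ /=.
  by apply: eq_bigr => c _; rewrite mxE.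
transitivity (\sum_c \sum_a \sum_b
   (\sum_r gs_comul G l a r * gs_comul G r b c) * (f 0 a * (g 0 b * h 0 c))).
  rewrite [RHS]exchange_big; apply: eq_bigr => a _ /=.
  by rewrite exchange_big.
apply: eq_bigr => c _.
transitivity (\sum_r \sum_a \sum_b gs_comul G l r c * gs_comul G r a b *
   (f 0 a * (g 0 b * h 0 c))).
  rewrite [RHS]exchange_big; apply: eq_bigr => a _ /=.
  rewrite [RHS]exchange_big; apply: eq_bigr => b _ /=.
  by rewrite -gs_comulA mulr_suml.
apply: eq_bigr => r _; rewrite mulr_suml mulr_sumr; apply: eq_bigr => a _.
by rewrite mulr_suml mulr_sumr; apply: eq_bigr => b _; rewrite !mulrA.
Qed.

Fact grpalg_mul1l : left_id grpalg_one grpalg_mul.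
Proof.
move=> f; apply/rowP => l; rewrite !mxE exchange_big /=.
rewrite (bigD1 l) //= [X in _ + X]big1 ?addr0 => [|j /negPf ne].
  under eq_bigr do rewrite mxE mulrA [_ * gs_counit _ _]mulrC.
  by rewrite -mulr_suml gs_counitl eqxx mul1r.
under eq_bigr do rewrite mxE mulrA [_ * gs_counit _ _]mulrC.
by rewrite -mulr_suml gs_counitl eq_sym ne mul0r.
Qed.

Fact grpalg_mul1r : right_id grpalg_one grpalg_mul.
Proof.
move=> f; apply/rowP => l; rewrite !mxE.
rewrite (bigD1 l) //= [X in _ + X]big1 ?addr0 => [|j /negPf ne].
  under eq_bigr do rewrite mxE mulrCA mulrC [_ * gs_counit _ _]mulrC.
  by rewrite -mulr_suml gs_counitr eqxx mul1r.
under eq_bigr do rewrite mxE mulrCA mulrC [_ * gs_counit _ _]mulrC.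
by rewrite -mulr_suml gs_counitr eq_sym ne mul0r.
Qed.

Fact grpalg_mulDl : left_distributive grpalg_mul +%R.
Proof.
move=> f g h; apply/rowP => l; rewrite !mxE -big_split; apply: eq_bigr => i _.
rewrite /= -big_split; apply: eq_bigr => j _.
by rewrite mxE /= mulrDl mulrDr.
Qed.

Fact grpalg_mulDr : right_distributive grpalg_mul +%R.
Proof.
move=> f g h; apply/rowP => l; rewrite !mxE -big_split; apply: eq_bigr => i _.
rewrite /= -big_split; apply: eq_bigr => j _.
by rewrite mxE /= !mulrDr.
Qed.

Fact grpalg_one_neq0 : grpalg_one != 0.
Proof.
apply/eqP => e0; have := gs_counit1 G; rewrite big1 => [|l _].
  by move/eqP; rewrite eq_sym oner_eq0.
by have := congr1 (fun f : 'rV_ _ => f 0 l) e0; rewrite !mxE => ->; rewrite mulr0.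
Qed.

HB.instance Definition _ := GRing.Zmodule_isNzRing.Build (grpalg G)
  grpalg_mulA grpalg_mul1l grpalg_mul1r grpalg_mulDl grpalg_mulDr
  grpalg_one_neq0.

Fact grpalg_scalel (c : k) (f g : grpalg G) : c *: (f * g) = (c *: f) * g.
Proof.
apply/rowP => l; rewrite !mxE mulr_sumr; apply: eq_bigr => i _.
rewrite mulr_sumr; apply: eq_bigr => j _.
by rewrite mxE -mulrA mulrCA.
Qed.

HB.instance Definition _ :=
  GRing.Lmodule_isLalgebra.Build k (grpalg G) grpalg_scalel.

Fact grpalg_scaler (c : k) (f g : grpalg G) : c *: (f * g) = f * (c *: g).
Proof.
apply/rowP => l; rewrite !mxE mulr_sumr; apply: eq_bigr => i _.
rewrite mulr_sumr; apply: eq_bigr => j _.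
by rewrite mxE mulrCA; congr (_ * _); rewrite mulrCA.
Qed.

HB.instance Definition _ :=
  GRing.Lalgebra_isAlgebra.Build k (grpalg G) grpalg_scaler.

(** The dual basis of [e_i]. *)
Definition grpalg_basis (i : 'I_(gs_order G)) : grpalg G := delta_mx 0 i.

(** The coproduct [(Delta f)(e_i (x) e_j) = f (e_i e_j)]: [grpalg_comul f i j]
    is the coefficient of [grpalg_basis i (x) grpalg_basis j]. *)
Definition grpalg_comul (f : grpalg G) (i j : 'I_(gs_order G)) : k :=
  \sum_l gs_mul G i j l * f 0 l.

(** The augmentation [f |-> f 1]. *)
Definition grpalg_counit (f : grpalg G) : k := \sum_l gs_one G l * f 0 l.

Lemma grpalg_sum (f : grpalg G) : f = \sum_i f 0 i *: grpalg_basis i.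
Proof. exact: (row_sum_delta f). Qed.

Lemma grpalg_mulE (f g : grpalg G) l :
  (f * g) 0 l = \sum_i \sum_j gs_comul G l i j * (f 0 i * g 0 j).
Proof. by rewrite mxE. Qed.

Lemma grpalg_oneE l : (1 : grpalg G) 0 l = gs_counit G l.
Proof. by rewrite mxE. Qed.

Lemma grpalg_basisM i j :
  grpalg_basis i * grpalg_basis j = \sum_l gs_comul G l i j *: grpalg_basis l.
Proof.
rewrite [LHS]grpalg_sum; apply: eq_bigr => l _; congr (_ *: _).
rewrite grpalg_mulE (bigD1 i) //= [X in _ + X]big1 ?addr0; last first.
  move=> a /negPf ne; rewrite big1 // => b _.
  by rewrite mxE ne andbF mul0r mulr0.
rewrite (bigD1 j) //= [X in _ + X]big1 ?addr0; last first.
  by move=> b /negPf ne; rewrite [grpalg_basis j 0 b]mxE ne andbF !mulr0.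
by rewrite !mxE !eqxx !mulr1.
Qed.

Lemma grpalg_comulM (f g : grpalg G) i j :
  grpalg_comul (f * g) i j =
  \sum_i1 \sum_i2 \sum_j1 \sum_j2 gs_comul G i i1 i2 * gs_comul G j j1 j2
    * (grpalg_comul f i1 j1 * grpalg_comul g i2 j2).
Proof.
transitivity (\sum_a \sum_b (\sum_l gs_mul G i j l * gs_comul G l a b)
    * (f 0 a * g 0 b)).
  rewrite /grpalg_comul; under eq_bigr do rewrite grpalg_mulE mulr_sumr.
  rewrite exchange_big; apply: eq_bigr => a _ /=.
  under eq_bigr do rewrite mulr_sumr.
  rewrite exchange_big; apply: eq_bigr => b _ /=.
  by rewrite mulr_suml; apply: eq_bigr => l _; rewrite mulrA.
under eq_bigr do under eq_bigr do rewrite gs_comulM mulr_suml.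
under eq_bigr do rewrite exchange_big.
rewrite exchange_big; apply: eq_bigr => i1 _ /=.
under eq_bigr do under eq_bigr do rewrite mulr_suml.
under eq_bigr do rewrite exchange_big.
rewrite exchange_big; apply: eq_bigr => i2 _ /=.
under eq_bigr do under eq_bigr do rewrite mulr_suml.
under eq_bigr do rewrite exchange_big.
rewrite exchange_big; apply: eq_bigr => j1 _ /=.
under eq_bigr do under eq_bigr do rewrite mulr_suml.
under eq_bigr do rewrite exchange_big.
rewrite exchange_big; apply: eq_bigr => j2 _ /=.
rewrite /grpalg_comul mulr_suml mulr_sumr; apply: eq_bigr => a _.
rewrite !mulr_sumr; apply: eq_bigr => b _.
by rewrite -!mulrA; do 2!congr (_ * _); congr (_ * _); rewrite mulrCA.
Qed.

End GroupAlgebra.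

(** Finite dimensional left modules, in a basis: [A] acts on the column vectors
    ['cV[k]_(fd_dim M)]. *)
Record fdmod (k : fieldType) (A : lalgType k) := FdMod {
  fd_dim : nat;
  fd_act : A -> 'M[k]_fd_dim;
  fd_linear : linear fd_act;
  fd_one : fd_act 1 = 1%:M;
  fd_mul : forall x y, fd_act (x * y) = fd_act x *m fd_act y
}.

HB.instance Definition _ (k : fieldType) (A : lalgType k) (M : fdmod A) :=
  GRing.isLinear.Build k A 'M[k]_(fd_dim M) _ (fd_act M) (@fd_linear k A M).

Definition fd_iso (k : fieldType) (A : lalgType k) (M N : fdmod A) : Prop :=
  exists P : 'M[k]_(fd_dim N, fd_dim M),
    [/\ row_free P, row_full P
      & forall x, P *m fd_act M x = fd_act N x *m P].

Section Restriction.
Variables (k : fieldType) (A B : lalgType k) (alpha : {lrmorphism B -> A}).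
Variable M : fdmod A.

Fact restr_linear : linear (fd_act M \o alpha).
Proof. by move=> c x y; rewrite /= !linearP. Qed.

Fact restr_one : (fd_act M \o alpha) 1 = 1%:M.
Proof. by rewrite /= rmorph1 fd_one. Qed.

Fact restr_mul x y :
  (fd_act M \o alpha) (x * y) = (fd_act M \o alpha) x *m (fd_act M \o alpha) y.
Proof. by rewrite /= rmorphM fd_mul. Qed.

Definition fd_restr : fdmod B := FdMod restr_linear restr_one restr_mul.

End Restriction.

Section DirectSum.
Variables (k : fieldType) (A : lalgType k) (n : nat) (M : 'I_n -> fdmod A).

Definition sum_act (x : A) : 'M[k]_(\sum_i fd_dim (M i)) :=
  \mxdiag_i fd_act (M i) x.

Fact sum_linear : linear sum_act.
Proof.
move=> c x y; rewrite /sum_act.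
under eq_mxdiag do rewrite linearP.
rewrite mxdiagD; congr (_ + _).
transitivity (\mxblock_(i, j) (c *: (if i == j
    then conform_mx 0 (fd_act (M i) x) else 0)
    : 'M[k]_(fd_dim (M i), fd_dim (M j)))).
  rewrite /mxdiag; apply: eq_mxblock => i j.
  case: eqP => [<-|_]; last by rewrite scaler0.
  by rewrite (conform_mx_id (0 : 'M_(fd_dim (M i), fd_dim (M i))))
    (conform_mx_id 0).
by apply/matrixP => a b; rewrite !mxE.
Qed.

Fact sum_one : sum_act 1 = 1%:M.
Proof. by rewrite /sum_act; under eq_mxdiag do rewrite fd_one; exact: mxdiagZ. Qed.

Fact sum_mul x y : sum_act (x * y) = sum_act x *m sum_act y.
Proof.
rewrite /sum_act mul_mxdiag_mxblock; apply: eq_mxblock => i j.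
by case: eqP => [<-|_]; rewrite ?mulmx0 // !conform_mx_id fd_mul.
Qed.

Definition fd_sum : fdmod A := FdMod sum_linear sum_one sum_mul.

End DirectSum.

Notation truncpoly K p := {poly %/ ('X^p : {poly K})}.

Section TruncatedPolynomials.
Variables (K : fieldType) (p : nat).

Lemma coef_truncpolyM (r s : truncpoly K p) n : (n < p)%N ->
  (r * s : truncpoly K p)`_n = \sum_(i < n.+1) r`_(n - i) * s`_i.
Proof.
move=> np; rewrite -coefMr poly_of_qpolyM.
move: (_ * _ : {poly K}) => q; rewrite mk_monic_Xn -Pdiv.RingMonic.take_poly_rmodp.
by rewrite coef_take_poly prednK ?np // (leq_ltn_trans _ np).
Qed.

(** The module [[i+1] = K[t]/t^(i+1)], restricted along the quotient map, in
    the basis [1, t, ..., t^i]; the column [v] lists the coefficients of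
    [r * t^v]. *)
Section Indecomposable.
Variable i : 'I_p.

Definition jordan_act (r : truncpoly K p) : 'M[K]_i.+1 :=
  \matrix_(u, v) if (v <= u)%N then r`_(u - v)%N else 0.

Fact jordan_linear : linear jordan_act.
Proof.
move=> c r s; apply/matrixP => u v; rewrite !mxE.
by case: ifP => _; rewrite ?coefD ?coefZ // mulr0 addr0.
Qed.

Fact jordan_one : jordan_act 1 = 1%:M.
Proof.
apply/matrixP => u v; rewrite !mxE.
rewrite [polyn _](_ : _ = 1%:P) // coefC subn_eq0 -val_eqE /=.
by case: ltngtP.
Qed.

Fact jordan_mul r s : jordan_act (r * s) = jordan_act r *m jordan_act s.
Proof.
apply/matrixP => u v; rewrite !mxE.
under [RHS]eq_bigr do rewrite !mxE.
case: leqP => [vu|uv]; last first.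
  rewrite big1 // => j _; case: leqP => [ju|]; last by rewrite mul0r.
  by rewrite leqNgt (leq_ltn_trans ju uv) mulr0.
have lt_uv : (u - v < p)%N.
  apply: leq_ltn_trans (leq_subr v u) _.
  exact: leq_ltn_trans (leq_ord u) (ltn_ord i).
rewrite coef_truncpolyM // -subSn // -(big_mkord xpredT
  (fun j => r`_(u - v - j)%N * s`_j)).
rewrite -(big_mkord xpredT (fun j => (if (j <= u)%N then r`_(u - j)%N else 0)
  * (if (v <= j)%N then s`_(j - v)%N else 0))).
rewrite [RHS](@big_cat_nat _ _ _ v) //=; last by rewrite ltnW.
rewrite [X in _ = X + _]big_nat_cond [X in _ = X + _]big1 ?add0r; last first=> [j|].
  by rewrite /= andbT => /ltn_geF ->; rewrite mulr0.
rewrite [RHS](@big_cat_nat _ _ _ u.+1) //=; last by rewrite leqW.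
rewrite [X in _ = _ + X]big_nat_cond [X in _ = _ + X]big1 ?addr0; last first=> [j|].
  by rewrite /= andbT => /andP[/ltn_geF -> _]; rewrite mul0r.
rewrite [RHS](big_addn 0 u.+1 v); apply: eq_big_nat => j /andP[_ jlt].
have jvu : (j + v <= u)%N by rewrite addnC -leq_subRL // -ltnS -subSn.
by rewrite leq_addl addnK jvu -subnDA addnC.
Qed.

Definition jordan_block : fdmod (truncpoly K p) :=
  FdMod jordan_linear jordan_one jordan_mul.

End Indecomposable.
End TruncatedPolynomials.

(** [M] has Jordan type [\sum_(i < p) a i [i+1]]. *)
Definition has_jordan_type (K : fieldType) (p : nat) (M : fdmod (truncpoly K p))
    (a : 'I_p -> nat) : Prop :=
  fd_iso M (fd_sum (fun i : 'I_p => fd_sum (fun _ : 'I_(a i) => jordan_block K i))).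

Section TensorProduct.
Variables (k : fieldType) (G : finGroupScheme k) (M N : fdmod (grpalg G)).

Notation actM i := (fd_act M (grpalg_basis i)).
Notation actN j := (fd_act N (grpalg_basis j)).

Definition tens_act (x : grpalg G) : 'M[k]_(fd_dim M * fd_dim N) :=
  \sum_i \sum_j grpalg_comul x i j *: (actM i *t actN j).

Fact tens_linear : linear tens_act.
Proof.
move=> c x y; rewrite /tens_act scaler_sumr -big_split; apply: eq_bigr => i _.
rewrite /= scaler_sumr -big_split; apply: eq_bigr => j _ /=.
rewrite scalerA -scalerDl; congr (_ *: _); rewrite /grpalg_comul mulr_sumr.
by rewrite -big_split; apply: eq_bigr => l _; rewrite !mxE /= mulrDr mulrCA.
Qed.

Let tensZl (m n q r : nat) (c : k) (A : 'M_(m, n)) (B : 'M_(q, r)) :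
  (c *: A) *t B = c *: (A *t B).
Proof. by apply/matrixP => i j; rewrite !mxE mulrA. Qed.

Let tensZr (m n q r : nat) (c : k) (A : 'M_(m, n)) (B : 'M_(q, r)) :
  A *t (c *: B) = c *: (A *t B).
Proof. by apply/matrixP => i j; rewrite !mxE mulrCA. Qed.

Let tens_suml (m n q r : nat) I (s : seq I) (A : I -> 'M[k]_(m, n))
    (B : 'M[k]_(q, r)) :
  (\sum_(i <- s) A i) *t B = \sum_(i <- s) A i *t B.
Proof.
apply/matrixP => i j; rewrite summxE !mxE summxE mulr_suml.
by apply: eq_bigr => l _; rewrite mxE.
Qed.

Let tens_sumr (m n q r : nat) I (s : seq I) (A : 'M[k]_(m, n))
    (B : I -> 'M[k]_(q, r)) :
  A *t (\sum_(i <- s) B i) = \sum_(i <- s) A *t B i.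
Proof.
apply/matrixP => i j; rewrite summxE !mxE summxE mulr_sumr.
by apply: eq_bigr => l _; rewrite mxE.
Qed.

Let act_sum (P : fdmod (grpalg G)) x :
  fd_act P x = \sum_i x 0 i *: fd_act P (grpalg_basis i).
Proof.
by rewrite {1}[x]grpalg_sum linear_sum; apply: eq_bigr => i _; rewrite linearZ.
Qed.

Fact tens_one : tens_act 1 = 1%:M.
Proof.
transitivity (fd_act M 1 *t fd_act N 1); last first.
  rewrite !fd_one; apply/matrixP => i j; rewrite !mxE -natrM mulnb.
  by rewrite -(can_eq (@mxtens_unindexK _ _)) -xpair_eqE -!surjective_pairing.
rewrite /tens_act (act_sum M) (act_sum N) tens_suml; apply: eq_bigr => i _.
rewrite tens_sumr; apply: eq_bigr => j _; rewrite tensZl tensZr scalerA.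
congr (_ *: _); rewrite !grpalg_oneE -gs_counitM /grpalg_comul.
by apply: eq_bigr => l _; rewrite grpalg_oneE.
Qed.

Fact tens_mul x y : tens_act (x * y) = tens_act x *m tens_act y.
Proof.
transitivity (\sum_i1 \sum_j1 \sum_i2 \sum_j2
  (grpalg_comul x i1 j1 * grpalg_comul y i2 j2) *:
  ((actM i1 *m actM i2) *t (actN j1 *m actN j2))); last first.
  rewrite /tens_act mulmx_suml; apply: eq_bigr => i1 _.
  rewrite mulmx_suml; apply: eq_bigr => j1 _.
  rewrite mulmx_sumr; apply: eq_bigr => i2 _.
  rewrite mulmx_sumr; apply: eq_bigr => j2 _.
  by rewrite -scalemxAl -scalemxAr scalerA tensmx_mul.
have actME i1 i2 : actM i1 *m actM i2 = \sum_i gs_comul G i i1 i2 *: actM i.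
  rewrite -fd_mul grpalg_basisM linear_sum.
  by apply: eq_bigr => i _; rewrite linearZ.
have actNE j1 j2 : actN j1 *m actN j2 = \sum_j gs_comul G j j1 j2 *: actN j.
  rewrite -fd_mul grpalg_basisM linear_sum.
  by apply: eq_bigr => j _; rewrite linearZ.
transitivity (\sum_i1 \sum_i2 \sum_j1 \sum_j2 \sum_i \sum_j
  (gs_comul G i i1 i2 * gs_comul G j j1 j2
    * (grpalg_comul x i1 j1 * grpalg_comul y i2 j2)) *: (actM i *t actN j)).
  rewrite /tens_act.
  under eq_bigr do under eq_bigr do rewrite grpalg_comulM scaler_suml.
  under eq_bigr do rewrite exchange_big /=.
  rewrite exchange_big; apply: eq_bigr => i1 _ /=.
  under eq_bigr do under eq_bigr do rewrite scaler_suml.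
  under eq_bigr do rewrite exchange_big /=.
  rewrite exchange_big; apply: eq_bigr => i2 _ /=.
  under eq_bigr do under eq_bigr do rewrite scaler_suml.
  under eq_bigr do rewrite exchange_big /=.
  rewrite exchange_big; apply: eq_bigr => j1 _ /=.
  under eq_bigr do under eq_bigr do rewrite scaler_suml.
  under eq_bigr do rewrite exchange_big /=.
  by rewrite exchange_big.
apply: eq_bigr => i1 _; rewrite [LHS]exchange_big; apply: eq_bigr => j1 _ /=.
apply: eq_bigr => i2 _; apply: eq_bigr => j2 _.
rewrite actME actNE tens_suml scaler_sumr; apply: eq_bigr => i _.
rewrite tens_sumr scaler_sumr; apply: eq_bigr => j _.
by rewrite tensZl tensZr !scalerA; congr (_ *: _); rewrite mulrC mulrA.
Qed.

(** [M (x)_k N], with [kG] acting through its coproduct. *)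
Definition fd_tens : fdmod (grpalg G) := FdMod tens_linear tens_one tens_mul.

End TensorProduct.

Section ModuleBaseChange.
Variables (k K : fieldType) (iota : {rmorphism k -> K}) (G : finGroupScheme k).
Variable M : fdmod (grpalg G).

Let GK := base_change iota G.
Let act (i : 'I_(gs_order G)) := fd_act M (grpalg_basis i).

Definition bcmod_act (x : grpalg GK) : 'M[K]_(fd_dim M) :=
  \sum_(i < gs_order G) x 0 i *: map_mx iota (act i).

Fact bcmod_linear : linear bcmod_act.
Proof.
move=> c x y; rewrite /bcmod_act scaler_sumr -big_split; apply: eq_bigr => i _.
by rewrite !mxE scalerDl scalerA.
Qed.

Fact bcmod_one : bcmod_act 1 = 1%:M.
Proof.
rewrite -(map_mx1 iota) -(fd_one M) [X in fd_act M X]grpalg_sum linear_sum.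
rewrite [RHS]raddf_sum; apply: eq_bigr => i _.
by rewrite linearZ /= map_mxZ grpalg_oneE (@grpalg_oneE K GK i).
Qed.

Fact bcmod_mul x y : bcmod_act (x * y) = bcmod_act x *m bcmod_act y.
Proof.
rewrite /bcmod_act mulmx_suml.
transitivity (\sum_i \sum_j (x 0 i * y 0 j) *: map_mx iota (act i *m act j));
  last first.
  apply: eq_bigr => i _; rewrite mulmx_sumr; apply: eq_bigr => j _.
  by rewrite -scalemxAl -scalemxAr scalerA map_mxM.
have actE i j : map_mx iota (act i *m act j)
  = \sum_l gs_comul GK l i j *: map_mx iota (act l).
  rewrite -fd_mul grpalg_basisM linear_sum raddf_sum.
  by apply: eq_bigr => l _; rewrite linearZ /= map_mxZ.
under eq_bigr do rewrite grpalg_mulE scaler_suml.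
rewrite exchange_big; apply: eq_bigr => i _ /=.
under eq_bigr do rewrite scaler_suml.
rewrite exchange_big; apply: eq_bigr => j _ /=.
by rewrite actE scaler_sumr; apply: eq_bigr => l _; rewrite scalerA mulrC.
Qed.

(** [M_K = K (x)_k M]. *)
Definition fd_base_change : fdmod (grpalg GK) :=
  FdMod bcmod_linear bcmod_one bcmod_mul.

End ModuleBaseChange.

(** A closed subgroup scheme [C] of [G]: the closed immersion is given by the
    surjective morphism of Hopf algebras [k[G] -> k[C]],
    [e_i |-> \sum_j sub_res i j e_j]. *)
Record subgroupScheme (k : fieldType) (G : finGroupScheme k) := SubgroupScheme {
  sub_gs :> finGroupScheme k;
  sub_res : 'M[k]_(gs_order G, gs_order sub_gs);
  sub_resM : forall i j s,
    \sum_l gs_mul G i j l * sub_res l s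
    = \sum_a \sum_b sub_res i a * sub_res j b * gs_mul sub_gs a b s;
  sub_res1 : forall s, \sum_i gs_one G i * sub_res i s = gs_one sub_gs s;
  sub_res_comul : forall i a b,
    \sum_l sub_res i l * gs_comul sub_gs l a b
    = \sum_c \sum_d gs_comul G i c d * (sub_res c a * sub_res d b);
  sub_res_counit : forall i,
    \sum_s sub_res i s * gs_counit sub_gs s = gs_counit G i;
  sub_res_surj : row_full sub_res
}.

(** The inclusion of group algebras [kC -> kG], dual to [k[G] -> k[C]]. *)
Definition sub_incl (k : fieldType) (G : finGroupScheme k)
    (C : subgroupScheme G) (f : grpalg C) : grpalg G := f *m (sub_res C)^T.

(** [C] is abelian: [k[C]] is cocommutative. *)
Definition abelian_scheme (k : fieldType) (C : finGroupScheme k) : Prop :=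
  forall l i j, gs_comul C l i j = gs_comul C l j i.

(** [C] is unipotent: every nonzero representation has a nonzero fixed
    vector. *)
Definition unipotent_scheme (k : fieldType) (C : finGroupScheme k) : Prop :=
  forall M : fdmod (grpalg C), (0 < fd_dim M)%N ->
    exists2 v : 'cV[k]_(fd_dim M), v != 0
      & forall x, fd_act M x *m v = grpalg_counit x *: v.

Section Flatness.
Variables (R : comNzRingType) (S : nzRingType) (alpha : {rmorphism R -> S}).

(** [\sum_(u <- s) u.1 (x) u.2 = 0] in [N (x)_R S], where [R] acts on [S] by
    left multiplication through [alpha]: by the universal property of the
    tensor product, the sum is killed by every [R]-balanced map. *)
Definition tensor_eq0 (N : lmodType R) (s : seq (N * S)) : Prop :=
  forall (T : zmodType) (phi : N -> S -> T),
    (forall n n' x, phi (n + n') x = phi n x + phi n' x) ->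
    (forall n x x', phi n (x + x') = phi n x + phi n x') ->
    (forall r n x, phi (r *: n) x = phi n (alpha r * x)) ->
    \sum_(u <- s) phi u.1 u.2 = 0.

Definition left_flat : Prop :=
  forall (N' N : lmodType R) (f : {linear N' -> N}), injective f ->
  forall s : seq (N' * S),
    tensor_eq0 [seq (f u.1, u.2) | u <- s] -> tensor_eq0 s.

End Flatness.

Record pi_point (p : nat) (k K : fieldType) (iota : {rmorphism k -> K})
    (G : finGroupScheme k) := PiPoint {
  pi_map : {lrmorphism truncpoly K p -> grpalg (base_change iota G)};
  pi_flat : left_flat pi_map;
  pi_factor : exists C : subgroupScheme (base_change iota G),
    [/\ abelian_scheme C, unipotent_scheme C
      & exists beta : {lrmorphism truncpoly K p -> grpalg C},
          forall r, pi_map r = sub_incl (beta r)]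
}.

Definition constant_jordan_type (p : nat) (k : fieldType) (G : finGroupScheme k)
    (M : fdmod (grpalg G)) : Prop :=
  exists a : 'I_p -> nat,
    forall (K : fieldType) (iota : {rmorphism k -> K}) (alpha : pi_point p iota G),
      has_jordan_type (fd_restr (pi_map alpha) (fd_base_change iota M)) a.

(* Main.v *)
From HB Require Import structures.
Require Import Defs.
From mathcomp Require Import all_boot all_order all_algebra.
From mathcomp Require Import mxtens zify.

Set Implicit Arguments.
Unset Strict Implicit.
Unset Printing Implicit Defensive.

Import GRing.Theory.
Local Open Scope ring_scope.

(** Write [A] for the group algebra [KC] of an abelian unipotent subgroup scheme
    and let [u] in [A] be the image of [t] under a pi-point.  If [t] acted on
    [M (x) N] by [u (x) 1 + 1 (x) u], the Jordan type of [M (x) N] would be that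
    of the tensor product of two nilpotent matrices of known types, the same for
    all pi-points.  It acts by [Delta u] instead, and the point is that
    [w = Delta u - u (x) 1 - 1 (x) u] does not change the Jordan type.

    Jordan types are tracked by the ranks of the powers of [t]
    ([jordan_typeP], [nilpotent_similar]); ranks do not change under extension of
    scalars.  Since [Delta] is a ring homomorphism and [A (x) A] is commutative of
    characteristic [p], [w^p = 0].  The kernel of the Frobenius map of [A (x) A] is
    [J (x) A + A (x) J], with [J] the ideal of [p]-nilpotent elements of [A], once
    the coefficients of [w] are [p]-th powers.  This is arranged by extending
    scalars along the Frobenius map [K -> K].  So [w] is a sum of terms
    [xi (x) b] and [b (x) xi], where [xi^p = 0] and [b] is in the augmentation
    ideal, hence nilpotent ([comul_frobenius_twist]).

    For [xi^p = 0] the generic point [u + s xi], over [K(s)], is again a pi-point: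
    flatness says that the rank of multiplication by [u^(p-1)] is as large as it
    can be, an open condition ([flat_rank], [rank_flat],
    [flat_nilpotent_pencil]).  As [M] and [N] have constant Jordan type, so does
    the family [(u + s xi) (x) 1 + 1 (x) (v + s' xi')] on [M (x) N].  It remains to
    replace the parameters by nilpotent operators [b] that commute with
    everything, and this is linear algebra ([rank_pencil_nilpotent]): for a pencil
    [X + s Xi] whose powers have the same ranks over [K(s)] as at [s = 0], the
    powers of [X + Xi b] have these ranks too.  The reason is that the
    translation [s |-> s + b] is an automorphism of [V (x) K[s]/s^Q] which, in
    characteristic [p], fixes a power [s^q] of [s].  The ranks of the translated
    operator times [s^a] thus agree with those of the original one for [a]
    divisible by [q], and the Frobenius rank inequality, a convexity in [a],
    forces agreement for all [a].  Several terms of [w] are removed one at a time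
    ([rank_class_nilpotent]). *)

(** * Ranks of powers of nilpotent matrices *)

Lemma mulmx_ring (R : pzRingType) n (X Y : 'M[R]_n) : X *m Y = X * Y.
Proof. by []. Qed.

Lemma mx1_ring (R : pzRingType) n : 1%:M = 1 :> 'M[R]_n.
Proof. by []. Qed.

Lemma intertwineX (R : pzRingType) m n (P : 'M[R]_(m, n)) X Y j :
  P *m X = Y *m P -> P *m X ^+ j = Y ^+ j *m P.
Proof.
move=> e; elim: j => [|j IH].
  by rewrite !expr0; exact: etrans (mulmx1 _) (esym (mul1mx _)).
by rewrite !exprSr -!mulmx_ring mulmxA IH -!mulmxA e.
Qed.

Lemma rank_similarX (K : fieldType) m n (P : 'M[K]_(m, n)) (Q : 'M_(n, m)) X Y j :
  Q *m P = 1%:M -> P *m Q = 1%:M -> P *m X = Y *m P ->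
  \rank (X ^+ j) = \rank (Y ^+ j).
Proof.
move=> QP PQ /(@intertwineX _ _ _ _ _ _ j) e.
have e' : Q *m Y ^+ j = X ^+ j *m Q.
  by rewrite -[LHS]mulmx1 -PQ !mulmxA -[_ *m P]mulmxA -e !mulmxA QP mul1mx.
apply/eqP; rewrite eqn_leq; apply/andP; split.
  rewrite -[X ^+ j]mul1mx -QP -mulmxA e.
  exact: leq_trans (mxrankM_maxr _ _) (mxrankM_maxl _ _).
rewrite -[Y ^+ j]mul1mx -PQ -mulmxA e'.
exact: leq_trans (mxrankM_maxr _ _) (mxrankM_maxl _ _).
Qed.

(** Frobenius' rank inequality, for two commuting factors on either side of
    [Y]. *)
Lemma rank_convex (K : fieldType) n (Y S : 'M[K]_n) : GRing.comm S Y ->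
  (2 * \rank (Y *m S) <= \rank Y + \rank (Y *m S *m S))%N.
Proof.
move=> c; have := mxrank_Frobenius S Y S.
by rewrite !mulmx_ring c addnn mul2n.
Qed.

Lemma rankX_convex (K : fieldType) n (X : 'M[K]_n) j :
  (2 * \rank (X ^+ j.+1) <= \rank (X ^+ j) + \rank (X ^+ j.+2))%N.
Proof.
rewrite !exprSr; apply: rank_convex; exact: commrX.
Qed.

(** A convex sequence lies below its chord on [[m, m + l]] and above the line of
    that chord elsewhere.  The bound at [0] then forces equality to the left of
    [m], and hence to its right. *)
Lemma convex_linear (g : nat -> nat) (r m l : nat) :
  (forall a, 2 * g a.+1 <= g a + g a.+2)%N ->
  (0 < m)%N -> (0 < l)%N ->
  (g 0%N <= r * (m + l))%N -> g m = (r * l)%N -> g (m + l)%N = 0%N ->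
  forall a, (a <= m + l)%N -> g a = (r * (m + l - a))%N.
Proof.
move=> cvx m0 l0 g0 gm gml.
have inc a b : (a <= b)%N -> (g a.+1 + g b <= g b.+1 + g a)%N.
  move=> ab; rewrite -(subnK ab); elim: (b - a)%N => [|d IH].
    by rewrite add0n addnC.
  by rewrite addSn; have := cvx (d + a)%N; lia.
(* slopes increase, so one above [- r] before [m] would overshoot at [m + l] *)
have before a : (a < m)%N -> (g a.+1 + r <= g a)%N.
  move=> am; rewrite leqNgt; apply/negP => bad.
  have st b : (a <= b)%N -> (g b < g b.+1 + r)%N by move=> /inc; lia.
  have up d : (0 < d)%N -> (g m < g (m + d) + r * d)%N.
    elim: d => // d IH _; have := st (m + d)%N; rewrite addnS.
    case: d IH => [|d] IH; first by rewrite addn0 muln1; lia.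
    by have := IH isT; rewrite mulnS; lia.
  by have := up l l0; rewrite gml gm; lia.
have after a : (m <= a)%N -> (g a <= g a.+1 + r)%N.
  move=> ma; rewrite leqNgt; apply/negP => bad.
  have st b : (b <= a)%N -> (g b.+1 + r < g b)%N by move=> /inc; lia.
  have dn d : (0 < d <= m)%N -> (g d + r * d < g 0%N)%N.
    elim: d => // d IH /andP[_ dm]; have := st d.
    case: d IH dm => [|d] IH dm; first by rewrite muln1; lia.
    by have := IH; rewrite !mulnS; lia.
  by have := dn m; rewrite m0 leqnn gm => /(_ isT); move: g0; rewrite mulnDr; lia.
have low a : (a <= m)%N -> (g a + r * a <= g 0%N)%N.
  elim: a => [|a IH] am; first by rewrite muln0 addn0.
  by have := before a am; have := IH (ltnW am); rewrite mulnS; lia.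
have low' d : (d <= m)%N -> (g m + r * d <= g (m - d)%N)%N.
  elim: d => [|d IH] dm; first by rewrite subn0 muln0 addn0.
  have := before (m - d.+1)%N; have -> : (m - d.+1).+1 = (m - d)%N by lia.
  by have := IH (ltnW dm); rewrite mulnS; lia.
have hi d : (g m <= g (m + d) + r * d)%N.
  elim: d => [|d IH]; first by rewrite addn0 muln0 addn0.
  by have := after (m + d)%N; rewrite addnS mulnS; lia.
have hi' d : (d <= l)%N -> (g (m + l - d) <= r * d)%N.
  elim: d => [|d IH] dl; first by rewrite subn0 gml muln0.
  have := after (m + l - d.+1)%N; have -> : (m + l - d.+1).+1 = (m + l - d)%N by lia.
  by have := IH (ltnW dl); rewrite mulnS; lia.
move=> a aml; have [am|ma] := leqP a m.
  have := low a am; have := low' (m - a)%N; move: g0; rewrite subKn // leq_subr gm.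
  have -> : (m + l - a = (m - a) + l)%N by lia.
  have -> : (m + l = a + ((m - a) + l))%N by lia.
  by rewrite !mulnDr => ? /(_ isT); lia.
have := hi (a - m)%N; have := hi' (m + l - a)%N.
rewrite subKn // subnKC ?(ltnW ma) // gm.
have -> : (l = (a - m) + (m + l - a))%N by lia.
by rewrite !mulnDr; lia.
Qed.

(** The losses of rank from one power of [X] to the next decrease, and the last of
    the first [p] is [\rank (X ^+ p.-1)].  The bound on [n], their sum, makes them
    all equal: [K^n] is free over [K[X]/X^p]. *)
Lemma free_rank (K : fieldType) n p (X : 'M[K]_n) :
  (0 < p)%N -> X ^+ p = 0 -> (n <= p * \rank (X ^+ p.-1))%N ->
  forall j, \rank (X ^+ j) = ((p - j) * \rank (X ^+ p.-1))%N.
Proof.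
move=> p0 Xp le_n; set r := \rank (X ^+ p.-1).
pose g j := \rank (X ^+ j).
have gp j : (p <= j)%N -> g j = 0%N.
  by move=> pj; rewrite /g -(subnK pj) exprD Xp mulr0 mxrank0.
have cvx := @rankX_convex K n X; rewrite -/(g _) in cvx.
have st d : (d < p)%N -> (r + g (p - d) <= g (p - d.+1))%N.
  elim: d => [|d IH] dp.
    by rewrite subn0 gp // addn0 subn1 leqnn.
  have := cvx (p - d.+2)%N.
  have -> : (p - d.+2).+2 = (p - d)%N by lia.
  have -> : (p - d.+2).+1 = (p - d.+1)%N by lia.
  by have := IH (ltnW dp); rewrite -!/(g _); lia.
have lo d : (d <= p)%N -> (d * r <= g (p - d))%N.
  elim: d => [|d IH] dp; first by rewrite mul0n.
  by have := st d dp; have := IH (ltnW dp); rewrite mulSn; lia.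
have hi j : (j <= p)%N -> (g j + j * r <= n)%N.
  elim: j => [|j IH] jp; first by rewrite /g expr0 mul0n addn0 rank_leq_row.
  have := st (p - j.+1)%N; have -> : (p - (p - j.+1))%N = j.+1 by lia.
  have -> : (p - (p - j.+1).+1)%N = j by lia.
  by have := IH (ltnW jp); rewrite mulSn; lia.
move=> j; have [jp|pj] := leqP j p; last first.
  by rewrite -/(g j) gp ?(ltnW pj) //; have -> : (p - j = 0)%N by lia.
have := hi j jp; have := lo (p - j)%N (leq_subr _ _); rewrite subKn //.
have : ((p - j) * r + j * r = p * r)%N by rewrite -mulnDl subnK.
by rewrite -/(g j); move: le_n; rewrite -/r; lia.
Qed.

Lemma nilpotent_index (K : fieldType) n (X : 'M[K]_n.+1) e :
  X ^+ e = 0 -> exists m, X ^+ m != 0 /\ X ^+ m.+1 = 0.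
Proof.
move=> Xe; have ex : exists m, X ^+ m == 0 by exists e; rewrite Xe.
case: (ex_minnP ex) => -[|m] /eqP X0 min.
  by move/eqP: X0; rewrite expr0 oner_eq0.
by exists m; split => //; apply/negP => /min; rewrite ltnn.
Qed.

(** The matrix of multiplication by [t] on [K[t]/t^m.+1] in the basis of the
    powers of [t]. *)
Definition shift_mx (K : fieldType) m : 'M[K]_m.+1 :=
  \matrix_(i, j) (i == j.+1 :> nat)%:R.

(** A Jordan block of maximal size splits off: when [X ^+ m] has a nonzero
    entry [(i, k)], the vectors [X^b e_k] span a cyclic submodule, and the
    linear forms [e_i^* X^(m-a)] restrict to a basis of its dual because their
    pairing is a triangular matrix with that entry on the diagonal. *)
Lemma max_block_splits (K : fieldType) n (X : 'M[K]_n) m :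
  X ^+ m != 0 -> X ^+ m.+1 = 0 ->
  exists r (P : 'M_(n, m.+1)) (Q : 'M_(m.+1, n)) (R : 'M_(n, r)) (S : 'M_(r, n)),
  [/\ [/\ Q *m P = 1%:M, S *m R = 1%:M, P *m Q + R *m S = 1%:M,
      Q *m R = 0 & S *m P = 0],
      X *m P = P *m shift_mx K m & Q *m X = shift_mx K m *m Q].
Proof.
move=> Xm Xm1; set J := shift_mx K m.
have [i [k Xik]] : exists i k, (X ^+ m) i k != 0.
  move/matrix0Pn: Xm => [i [k ?]]; by exists i, k.
pose P0 : 'M_(n, m.+1) := \matrix_(a < n, b < m.+1) (X ^+ b) a k.
pose Q0 : 'M_(m.+1, n) := \matrix_(a < m.+1, b < n) (X ^+ (m - a)) i b.
have XP0 : X *m P0 = P0 *m J.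
  apply/matrixP => a b.
  have -> : (X *m P0) a b = (X ^+ b.+1) a k.
    by rewrite exprS -mulmx_ring !mxE; apply: eq_bigr => c _; rewrite !mxE.
  rewrite mxE; have [bm|mb] := ltnP b m.
    rewrite (bigD1 (inord b.+1)) //= big1 ?addr0 => [|c ne].
      by rewrite !mxE inordK // eqxx mulr1.
    rewrite !mxE; case: eqP => [e|]; rewrite ?mulr0 //.
    by case/eqP: ne; apply: val_inj; rewrite /= inordK.
  have -> : b.+1 = m.+1 by have := ltn_ord b; lia.
  rewrite Xm1 mxE big1 // => c _; rewrite !mxE; case: eqP => [e|]; rewrite ?mulr0 //.
  by have := ltn_ord c; rewrite e ltnS ltnNge mb.
have Q0X : Q0 *m X = J *m Q0.
  apply/matrixP => a b.
  have -> : (Q0 *m X) a b = (X ^+ (m - a).+1) i b.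
    by rewrite exprSr -mulmx_ring !mxE; apply: eq_bigr => c _; rewrite !mxE.
  rewrite mxE; case: (posnP a) => [a0|apos].
    rewrite a0 subn0 Xm1 mxE big1 // => c _; rewrite !mxE a0.
    by rewrite mul0r.
  have am : (a.-1 < m.+1)%N by rewrite prednK // ltnW.
  rewrite (bigD1 (Ordinal am)) //= big1 ?addr0 => [|c ne].
    rewrite !mxE /= prednK // eqxx mul1r; congr ((X ^+ _) _ _).
    by have := ltn_ord a; lia.
  rewrite !mxE; case: eqP => [e|]; rewrite ?mul0r //.
  by case/eqP: ne; apply: val_inj; rewrite /= e.
pose Z := Q0 *m P0.
have ZE a b : Z a b = (X ^+ (m - a + b)) i k.
  rewrite exprD -mulmx_ring !mxE; apply: eq_bigr => c _; rewrite !mxE.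
  by [].
have Zu : Z \in unitmx.
  rewrite unitmxE det_trig; last first.
    apply/is_trig_mxP => a b ab; rewrite ZE.
    have -> : (m - a + b = m.+1 + (b - a).-1)%N by have := ltn_ord a; lia.
    by rewrite exprD Xm1 mul0r mxE.
  rewrite unitfE; apply/prodf_neq0 => a _; rewrite ZE subnK //.
  exact: leq_ord.
have ZJ : Z *m J = J *m Z by rewrite /Z -mulmxA -XP0 mulmxA Q0X mulmxA.
have ZVJ : invmx Z *m J = J *m invmx Z.
  apply: (can_inj (mulmxK Zu)).
  by rewrite -!mulmxA -ZJ mulVmx // mulmx1 mulmxA mulVmx // mul1mx.
pose P := P0 *m invmx Z.
have QP : Q0 *m P = 1%:M by rewrite mulmxA mulmxV.
pose E := 1%:M - P *m Q0.
have EP : E *m P = 0 by rewrite mulmxBl mul1mx -mulmxA QP mulmx1 subrr.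
have EE : E *m E = E by rewrite {2}/E mulmxBr mulmx1 mulmxA EP mul0mx subr0.
have QE : Q0 *m E = 0 by rewrite mulmxBr mulmx1 mulmxA QP mul1mx subrr.
pose R := col_base E; pose S := row_base E.
have RS : R *m S = E := mulmx_base E.
have RV : pinvmx R *m R = 1%:M by apply: mulVpmx; exact: col_base_full.
have SV : S *m pinvmx S = 1%:M by apply: mulmxVp; exact: row_base_free.
have retract r (A : 'M[K]_(n, r)) (B : 'M[K]_(r, n)) A' B' :
    A' *m A = 1%:M -> B *m B' = 1%:M -> A *m B *m (A *m B) = A *m B ->
    B *m A = 1%:M.
  move=> AV BV /(congr1 (fun W => A' *m W *m B')).
  by rewrite !mulmxA AV !mul1mx -!mulmxA BV mulmx1.
exists (\rank E), P, Q0, R, S; split; last by [].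
  split => //.
  - by apply: (retract _ _ _ _ _ RV SV); rewrite RS.
  - by rewrite RS /E addrC subrK.
  - by rewrite -[LHS]mulmx1 -SV mulmxA -[_ *m S]mulmxA RS QE mul0mx.
  - by rewrite -[LHS]mul1mx -RV -mulmxA [R *m _]mulmxA RS EP mulmx0.
by rewrite /P mulmxA XP0 -!mulmxA ZVJ.
Qed.

Lemma rank_split (K : fieldType) n r m (X : 'M[K]_n) (J : 'M_m)
    (P : 'M_(n, m)) (Q : 'M_(m, n)) (R : 'M_(n, r)) (S : 'M_(r, n)) j :
  Q *m P = 1%:M -> S *m R = 1%:M -> P *m Q + R *m S = 1%:M ->
  Q *m R = 0 -> S *m P = 0 -> X *m P = P *m J -> Q *m X = J *m Q ->
  [/\ X *m R = R *m (S *m X *m R), S *m X = S *m X *m R *m S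
    & \rank (X ^+ j) = (\rank (J ^+ j) + \rank ((S *m X *m R) ^+ j)%R)%N].
Proof.
move=> QP SR id QR SP XP QX.
have XR : X *m R = R *m (S *m X *m R).
  rewrite -[LHS]mul1mx -id mulmxDl -!mulmxA [Q *m (X *m R)]mulmxA QX.
  by rewrite -mulmxA QR !mulmx0 add0r.
have SX : S *m X = S *m X *m R *m S.
  rewrite -[LHS]mulmx1 -id mulmxDr -!mulmxA [X *m (P *m Q)]mulmxA XP.
  by rewrite !mulmxA SP !mul0mx add0r.
split=> //; set X' := S *m X *m R in XR SX *.
have blockX i : block_mx J 0 0 X' ^+ i = block_mx (J ^+ i) 0 0 (X' ^+ i).
  elim: i => [|i IH]; first by rewrite !expr0 -scalar_mx_block.
  rewrite !exprS IH -!mulmx_ring mulmx_block.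
  by rewrite !mul0mx !mulmx0 !addr0 !add0r.
rewrite -rank_diag_block_mx -blockX.
apply: (@rank_similarX _ _ _ (col_mx Q S) (row_mx P R)).
- by rewrite mul_row_col.
- by rewrite mul_col_row QP QR SP SR -scalar_mx_block.
- rewrite mul_col_mx mul_block_col !mul0mx addr0 add0r QX.
  by rewrite {1}SX.
Qed.

(** Nilpotent matrices are classified by the ranks of their powers: both split
    off a block of the same maximal size, and the ranks of the powers of the
    remainders again agree. *)
Lemma nilpotent_similar (K : fieldType) n n' (X : 'M[K]_n) (Y : 'M[K]_n') e :
  X ^+ e = 0 -> Y ^+ e = 0 ->
  (forall j, \rank (X ^+ j) = \rank (Y ^+ j)) ->
  exists (P : 'M_(n', n)) (Q : 'M_(n, n')),
    [/\ Q *m P = 1%:M, P *m Q = 1%:M & P *m X = Y *m P].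
Proof.
have [N] := ubnP n; elim: N n n' X Y => // N IH n n' X Y nN Xe Ye rk.
have := rk 0%N; rewrite !expr0 !mxrank1 => en; case: n' / en Y Ye rk => Y Ye rk.
case: n nN X Y Xe Ye rk => [|n] nN X Y Xe Ye rk.
  by exists 1%:M, 1%:M; split; apply/matrixP; case.
have [m [Xm Xm1]] := nilpotent_index Xe.
have Ym : Y ^+ m != 0 by rewrite -mxrank_eq0 -rk mxrank_eq0.
have Ym1 : Y ^+ m.+1 = 0 by apply/eqP; rewrite -mxrank_eq0 -rk mxrank_eq0 Xm1.
have [r [P [Q [R [S [[QP SR id QR SP] XP QX]]]]]] := max_block_splits Xm Xm1.
have [r' [P' [Q' [R' [S' [[QP' SR' id' QR' SP'] YP QY]]]]]] :=
  max_block_splits Ym Ym1.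
have sX j := rank_split j QP SR id QR SP XP QX.
have sY j := rank_split j QP' SR' id' QR' SP' YP QY.
have [XR SX _] := sX 0%N; have [YR SY _] := sY 0%N.
have X1e : (S *m X *m R) ^+ e = 0.
  apply/eqP; rewrite -mxrank_eq0 -leqn0; have [_ _] := sX e.
  by rewrite Xe mxrank0; lia.
have Y1e : (S' *m Y *m R') ^+ e = 0.
  apply/eqP; rewrite -mxrank_eq0 -leqn0; have [_ _] := sY e.
  by rewrite Ye mxrank0; lia.
have rN : (r < N)%N.
  have [_ _] := sX 0%N; rewrite !expr0 !mxrank1; lia.
have [j|F [G [GF FG FX]]] := IH _ _ _ _ rN X1e Y1e.
  by have [_ _] := sX j; have [_ _] := sY j; rewrite rk; lia.
exists (P' *m Q + R' *m F *m S), (P *m Q' + R *m G *m S'); split.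
- rewrite mulmxDl !mulmxDr -!mulmxA.
  rewrite [Q' *m (P' *m _)]mulmxA QP' mul1mx [Q' *m (R' *m _)]mulmxA QR'.
  rewrite mul0mx mulmx0 addr0 [S' *m (P' *m _)]mulmxA SP' mul0mx !mulmx0 add0r.
  by rewrite [S' *m (R' *m _)]mulmxA SR' mul1mx [G *m (F *m _)]mulmxA GF mul1mx.
- rewrite mulmxDl !mulmxDr -!mulmxA.
  rewrite [Q *m (P *m _)]mulmxA QP mul1mx [Q *m (R *m _)]mulmxA QR.
  rewrite mul0mx mulmx0 addr0 [S *m (P *m _)]mulmxA SP mul0mx !mulmx0 add0r.
  by rewrite [S *m (R *m _)]mulmxA SR mul1mx [F *m (G *m _)]mulmxA FG mul1mx.
rewrite mulmxDl mulmxDr -!mulmxA QX [Y *m (P' *m _)]mulmxA YP -!mulmxA.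
congr (_ + _); rewrite [Y *m (R' *m _)]mulmxA YR -!mulmxA; congr (_ *m _).
rewrite {1}SX -!mulmxA [S *m (X *m _)]mulmxA [S *m X *m (R *m S)]mulmxA.
by rewrite mulmxA FX -!mulmxA.
Qed.

(** * Jordan types and ranks *)

Section Truncated.
Variables (K : fieldType) (p : nat).
Hypothesis p_gt0 : (0 < p)%N.
Local Notation R := (truncpoly K p).
Local Notation t := ('qX : R).

Lemma coef_qXn j n : (n < p)%N -> (t ^+ j)`_n = (n == j)%:R.
Proof.
move=> np; rewrite -[t]/(in_qpoly _ 'X) -rmorphXn /= mk_monic_Xn.
rewrite -Pdiv.RingMonic.take_poly_rmodp coef_take_poly prednK // np.
by rewrite coefXn.
Qed.

Lemma size_truncpoly (r : R) : (size (r : {poly K}) <= p)%N.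
Proof.
by apply: leq_trans (size_npoly r) _; rewrite mk_monic_Xn size_polyXn prednK.
Qed.

Lemma truncpolyP (r s : R) : (forall n, (n < p)%N -> r`_n = s`_n) -> r = s.
Proof.
move=> e; apply/val_inj/polyP => n; have [/e //|pn] := ltnP n p.
by rewrite !nth_default // (leq_trans (size_truncpoly _)).
Qed.

Lemma truncpoly_sum (r : R) : r = \sum_(i < p) r`_i *: t ^+ i.
Proof.
apply: truncpolyP => n np; rewrite coefn_sum (bigD1 (Ordinal np)) //=.
rewrite coefZ coef_qXn // eqxx mulr1 big1 ?addr0 // => i ne.
rewrite coefZ coef_qXn // -val_eqE /= in ne *.
by rewrite eq_sym (negPf ne) mulr0.
Qed.

Lemma qXp0 : t ^+ p = 0.
Proof.
by apply: truncpolyP => n np; rewrite coef_qXn // coef0 ltn_eqF.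
Qed.

Lemma fd_actX (A : lalgType K) (M : fdmod A) x j :
  fd_act M (x ^+ j) = fd_act M x ^+ j.
Proof.
elim: j => [|j IH]; first by rewrite !expr0 fd_one.
by rewrite !exprS fd_mul IH.
Qed.

Lemma fd_act_qX (M : fdmod R) r :
  fd_act M r = \sum_(i < p) r`_i *: fd_act M t ^+ i.
Proof.
rewrite {1}[r]truncpoly_sum linear_sum; apply: eq_bigr => i _.
by rewrite linearZ /= fd_actX.
Qed.

Lemma intertwine_qX (M N : fdmod R) (P : 'M_(fd_dim N, fd_dim M)) :
  P *m fd_act M t = fd_act N t *m P -> forall r, P *m fd_act M r = fd_act N r *m P.
Proof.
move=> e r; rewrite (fd_act_qX M) (fd_act_qX N) mulmx_sumr mulmx_suml.
apply: eq_bigr => i _.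
by rewrite -scalemxAr -scalemxAl (intertwineX _ e).
Qed.

Lemma rank_jordan_block (i : 'I_p) j :
  \rank (fd_act (jordan_block K i) t ^+ j) = (i.+1 - j)%N.
Proof.
pose J := fd_act (jordan_block K i) t; rewrite -/J.
have JE m : J ^+ m = fd_act (jordan_block K i) (t ^+ m) by rewrite fd_actX.
have small (u v : 'I_i.+1) : (u - v < p)%N.
  by have := ltn_ord u; have := ltn_ord i; lia.
have J0 : J ^+ i.+1 = 0.
  rewrite JE; apply/matrixP => u v; rewrite !mxE; case: ifP => // _.
  by rewrite coef_qXn // ltn_eqF // ltnS leq_subLR (leq_trans (leq_ord u)) ?leq_addl.
have J1 : (0 < \rank (J ^+ i))%N.
  rewrite lt0n mxrank_eq0; apply/eqP => /matrixP /(_ ord_max ord0).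
  by rewrite JE !mxE /= subn0 coef_qXn // eqxx; move/eqP; rewrite oner_eq0.
have rk := free_rank (ltn0Sn i) J0 (leq_pmulr _ J1).
have r1 : \rank (J ^+ i) = 1%N.
  by have := rk 0%N; rewrite expr0 mxrank1 subn0 /=; nia.
by rewrite rk /= r1 muln1.
Qed.

Definition jordan_module (a : 'I_p -> nat) : fdmod R :=
  fd_sum (fun i : 'I_p => fd_sum (fun _ : 'I_(a i) => jordan_block K i)).

Definition jordan_rank (a : 'I_p -> nat) (j : nat) : nat :=
  (\sum_(i < p) a i * (i.+1 - j))%N.

Lemma rank_jordan_module a j :
  \rank (fd_act (jordan_module a) t ^+ j) = jordan_rank a j.
Proof.
rewrite -fd_actX /= /sum_act rank_mxdiag; apply: eq_bigr => i _.
rewrite /= /sum_act rank_mxdiag -(rank_jordan_block i j) -fd_actX.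
by rewrite sum_nat_const card_ord.
Qed.

(** Ranks replace isomorphisms of modules from here on: they are insensitive to
    extension of scalars, and semicontinuous in families. *)
Lemma jordan_typeP (M : fdmod R) a :
  has_jordan_type M a <-> forall j, \rank (fd_act M t ^+ j) = jordan_rank a j.
Proof.
rewrite /has_jordan_type -/(jordan_module a); split.
  move=> [P [/mulmxVp PV /mulVpmx VP e]] j.
  by rewrite -rank_jordan_module; apply: rank_similarX VP PV (e t).
move=> rk.
have nil (N : fdmod R) : fd_act N t ^+ p = 0 by rewrite -fd_actX qXp0 linear0.
have [|P [Q [QP PQ e]]] := nilpotent_similar (nil M) (nil (jordan_module a)).
  by move=> j; rewrite rk rank_jordan_module.
exists P; split.
- by apply/row_freeP; exists Q.
- by apply/row_fullP; exists Q.
exact: intertwine_qX e.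
Qed.

End Truncated.

(** The number of blocks of size [i + 1] of a nilpotent matrix is the second
    difference of the ranks of its powers. *)
Lemma nilpotent_jordan_rank (K : fieldType) (p n : nat) (X : 'M[K]_n) :
  X ^+ p = 0 -> exists a : 'I_p -> nat,
    forall j, \rank (X ^+ j) = jordan_rank a j.
Proof.
move=> Xp; pose g j := \rank (X ^+ j).
have gp j : (p <= j)%N -> g j = 0%N.
  by move=> pj; rewrite /g -(subnK pj) exprD Xp mulr0 mxrank0.
have cvx j : (2 * g j.+1 <= g j + g j.+2)%N := rankX_convex X j.
exists (fun i => g i + g i.+2 - 2 * g i.+1)%N => j; rewrite -/(g j).
have [pj|jp] := leqP p j.
  rewrite gp // /jordan_rank big1 // => i _.
  by have := ltn_ord i; move=> ip; rewrite (_ : _ - j = 0)%N ?muln0 //; lia.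
pose a i := (g i + g i.+2 - 2 * g i.+1)%N.
have tail d : (d <= p)%N ->
    (\sum_(p - d <= i < p) a i * (i.+1 - (p - d)) = g (p - d)
    /\ \sum_(p - d <= i < p) a i + g (p - d).+1 = g (p - d))%N.
  elim: d => [|d IH] dp.
    by rewrite subn0 !big_geq // !gp.
  have [IH1 IH2] := IH (ltnW dp); set m := (p - d.+1)%N.
  have mE : (p - d = m.+1)%N by rewrite /m; lia.
  rewrite mE in IH1 IH2.
  have mp : (m < p)%N by rewrite /m; lia.
  have am : (a m + 2 * g m.+1 = g m + g m.+2)%N.
    by rewrite /a; have := cvx m; lia.
  split; last first.
    by rewrite big_ltn //; lia.
  rewrite big_ltn // subSnn muln1.
  have -> : (\sum_(m.+1 <= i < p) a i * (i.+1 - m)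
     = \sum_(m.+1 <= i < p) a i * (i.+1 - m.+1) + \sum_(m.+1 <= i < p) a i)%N.
    rewrite -big_split; apply: eq_big_nat => i /andP[mi _] /=.
    by rewrite -mulnSr; congr (_ * _)%N; lia.
  by rewrite IH1; lia.
have [] := tail (p - j)%N (leq_subr _ _); rewrite subKn ?(ltnW jp) // => <- _.
rewrite /jordan_rank -(big_mkord xpredT (fun i => a i * (i.+1 - j))%N).
rewrite (big_cat_nat (leq0n j) (ltnW jp)) /= [X in _ = (X + _)%N](_ : _ = 0%N) //.
rewrite big_nat big1 // => i /andP[_ ij].
by rewrite (_ : _ - j = 0)%N ?muln0 //; lia.
Qed.

(** * Tensor products of matrices and polynomial matrices *)

Lemma rank_tens (K : fieldType) m n m' n' (A : 'M[K]_(m, n)) (B : 'M[K]_(m', n')) :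
  \rank (A *t B) = (\rank A * \rank B)%N.
Proof.
have cb a b (C : 'M[K]_(a, b)) : pinvmx (col_base C) *m col_base C = 1%:M.
  by apply: mulVpmx; exact: col_base_full.
have rb a b (C : 'M[K]_(a, b)) : row_base C *m pinvmx (row_base C) = 1%:M.
  by apply: mulmxVp; exact: row_base_free.
have t1 a b : (1%:M : 'M[K]_a) *t (1%:M : 'M[K]_b) = 1%:M.
  apply/matrixP => i j; rewrite !mxE -natrM mulnb.
  by rewrite -(can_eq (@mxtens_unindexK _ _)) -xpair_eqE -!surjective_pairing.
rewrite -{1}(mulmx_base A) -{1}(mulmx_base B) -tensmx_mul.
set U := col_base A *t _; set V := _ *t row_base B.
apply/eqP; rewrite eqn_leq; apply/andP; split.
  by apply: leq_trans (mxrankM_maxr _ _) _; exact: rank_leq_row.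
pose U' := pinvmx (col_base A) *t pinvmx (col_base B).
pose V' := pinvmx (row_base A) *t pinvmx (row_base B).
have e : U' *m (U *m V) *m V' = 1%:M.
  rewrite !mulmxA /U' /U tensmx_mul !cb t1 mul1mx.
  by rewrite /V /V' tensmx_mul !rb t1.
have : (\rank (U' *m (U *m V) *m V') <= \rank (U *m V))%N.
  exact: leq_trans (mxrankM_maxl _ _) (mxrankM_maxr _ _).
by rewrite e mxrank1.
Qed.

Lemma tens1 (R : comPzRingType) a b : (1%:M : 'M[R]_a) *t (1%:M : 'M[R]_b) = 1%:M.
Proof.
apply/matrixP => i j; rewrite !mxE -natrM mulnb.
by rewrite -(can_eq (@mxtens_unindexK _ _)) -xpair_eqE -!surjective_pairing.
Qed.

Lemma tens_sumr (R : comPzRingType) m n m' n' I (s : seq I) (A : 'M[R]_(m, n))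
    (B : I -> 'M[R]_(m', n')) :
  A *t (\sum_(i <- s) B i) = \sum_(i <- s) A *t B i.
Proof.
apply/matrixP => i j; rewrite summxE !mxE summxE mulr_sumr.
by apply: eq_bigr => l _; rewrite mxE.
Qed.

Lemma tens_suml (R : comPzRingType) m n m' n' I (s : seq I)
    (A : I -> 'M[R]_(m, n)) (B : 'M[R]_(m', n')) :
  (\sum_(i <- s) A i) *t B = \sum_(i <- s) A i *t B.
Proof.
apply/matrixP => i j; rewrite summxE !mxE summxE mulr_suml.
by apply: eq_bigr => l _; rewrite mxE.
Qed.

Lemma tensZl (R : comPzRingType) m n m' n' (c : R) (A : 'M_(m, n)) (B : 'M_(m', n')) :
  (c *: A) *t B = c *: (A *t B).
Proof. by apply/matrixP => i j; rewrite !mxE mulrA. Qed.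

Lemma tensZr (R : comPzRingType) m n m' n' (c : R) (A : 'M_(m, n)) (B : 'M_(m', n')) :
  A *t (c *: B) = c *: (A *t B).
Proof. by apply/matrixP => i j; rewrite !mxE mulrCA. Qed.

Lemma tensX (R : comPzRingType) m n (A : 'M[R]_m) (C : 'M[R]_n) j :
  (A *t C) ^+ j = (A ^+ j) *t (C ^+ j).
Proof.
elim: j => [|j IH]; first by rewrite !expr0; exact/esym/tens1.
by rewrite !exprS IH -!mulmx_ring tensmx_mul.
Qed.

Lemma exprD_pchar_comm (K : fieldType) p n (x y : 'M[K]_n) e :
  p \in [pchar K] -> GRing.comm x y ->
  (x + y) ^+ (p ^ e) = x ^+ (p ^ e) + y ^+ (p ^ e).
Proof.
case: n x y => [|n] x y pK c; first by apply/matrixP; case.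
have pM : p \in [pchar 'M[K]_n.+1] by exact: rmorph_pchar (@scalar_mx K n.+1) _ pK.
elim: e => [|e IH]; first by rewrite expn0 !expr1.
rewrite expnSr !exprM IH -!(pFrobenius_autE pM) pFrobenius_autD_comm //.
by apply: commrX; apply/commr_sym/commrX/commr_sym.
Qed.

(** A constant compression of [F] that is invertible at [s = 0] stays
    invertible near [0]: it plays the role of a nonvanishing minor. *)
Lemma compression_at0 (K : fieldType) n (F : 'M[{poly K}]_n) :
  exists (P : 'M_(\rank (map_mx (horner_eval 0%R) F), n)) (Q : 'M_(n, _)),
    (\det (map_mx polyC P *m F *m map_mx polyC Q)).[0] = 1.
Proof.
set F0 := map_mx _ F.
exists (pinvmx (col_base F0)), (pinvmx (row_base F0)).
set P := pinvmx _; set Q := pinvmx _.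
have PFQ : P *m F0 *m Q = 1%:M.
  transitivity (P *m (col_base F0 *m row_base F0) *m Q); first by rewrite mulmx_base.
  rewrite (mulmxA P) (mulVpmx (col_base_full F0)) mul1mx.
  exact: mulmxVp (row_base_free F0).
have ev0C m' n' (A : 'M[K]_(m', n')) : map_mx (horner_eval 0) (map_mx polyC A) = A.
  by apply/matrixP => a b; rewrite !mxE /= horner_evalE hornerC.
rewrite -horner_evalE -det_map_mx !map_mxM !ev0C PFQ; exact: det1.
Qed.

Section PolyMatrixAt.
Variables (K : fieldType) (q : nat) (S : 'M[K]_q.+1).

(** The indeterminate becomes [1 (x) S], so that the result acts on
    [K^n (x) K^q.+1]. *)
Definition polymx_at m n (F : 'M[{poly K}]_(m, n)) : 'M[K]_(m * q.+1, n * q.+1) :=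
  \matrix_(u, v) horner_mx S (F (mxtens_unindex u).1 (mxtens_unindex v).1)
    (mxtens_unindex u).2 (mxtens_unindex v).2.

Let hornerM (f g : {poly K}) : horner_mx S (f * g) = horner_mx S f *m horner_mx S g.
Proof. exact: rmorphM. Qed.

Lemma polymx_atM m n r (F : 'M_(m, n)) (G : 'M_(n, r)) :
  polymx_at (F *m G) = polymx_at F *m polymx_at G.
Proof.
apply/matrixP => u v; rewrite !mxE rmorph_sum /= summxE.
transitivity (\sum_b \sum_y
    (horner_mx S (F (mxtens_unindex u).1 b) (mxtens_unindex u).2 y
    * horner_mx S (G b (mxtens_unindex v).1) y (mxtens_unindex v).2)).
  by apply: eq_bigr => b _; rewrite hornerM mxE.
rewrite pair_bigA /= [RHS](reindex (@mxtens_index n q.+1)) /=; last first.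
  exists (@mxtens_unindex n q.+1) => w _; [exact: mxtens_indexK|exact: mxtens_unindexK].
by apply: eq_bigr => w _; rewrite !mxE mxtens_indexK.
Qed.

Lemma polymx_atD m n (F G : 'M_(m, n)) :
  polymx_at (F + G) = polymx_at F + polymx_at G.
Proof. by apply/matrixP => u v; rewrite !mxE rmorphD mxE. Qed.

Lemma polymx_atZ m n (A : 'M[K]_(m, n)) (f : {poly K}) :
  polymx_at (f *: map_mx polyC A) = A *t horner_mx S f.
Proof.
apply/matrixP => u v; rewrite !mxE mulrC hornerM horner_mx_C.
by rewrite mul_scalar_mx mxE.
Qed.

Lemma polymx_atC m n (A : 'M[K]_(m, n)) :
  polymx_at (map_mx polyC A) = A *t 1%:M.
Proof. by rewrite -[map_mx _ _]scale1r polymx_atZ rmorph1. Qed.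

Lemma polymx_atX n (F : 'M_n) j : polymx_at (F ^+ j) = polymx_at F ^+ j.
Proof.
elim: j => [|j IH]; last by rewrite !exprS -!mulmx_ring polymx_atM IH.
rewrite !expr0 -!mx1_ring -(map_mx1 polyC) polymx_atC; exact: tens1.
Qed.

(** If the rank [r] of [F] over [K(s)] is already attained at [s = 0], then [F]
    factors through a free module of rank [r] near [0], and therefore after any
    nilpotent substitution. *)
Lemma rank_polymx_at n (F : 'M[{poly K}]_n) :
  S ^+ q.+1 = 0 ->
  \rank (map_mx (@tofrac _) F) = \rank (map_mx (horner_eval 0) F) ->
  (\rank (polymx_at F) <= \rank (map_mx (horner_eval 0%R) F) * q.+1)%N.
Proof.
move=> Sq; set F0 := map_mx _ F; set r := \rank F0 => rkF.
have [P [Q d0]] := compression_at0 F; rewrite -/F0 -/r in P Q d0.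
pose Pc := map_mx polyC P; pose Qc := map_mx polyC Q.
pose Z := Pc *m F *m Qc; pose d := \det Z; rewrite -/Pc -/Qc -/Z -/d in d0.
have dN0 : d != 0 by apply: contra_eq_neq d0 => ->; rewrite horner0 eq_sym oner_eq0.
have fac : d *: F = F *m Qc *m \adj Z *m (Pc *m F).
  pose tf := @tofrac {poly K}.
  have inj m' n' : injective (map_mx tf : 'M_(m', n') -> 'M_(m', n')).
    move=> A B /matrixP e; apply/matrixP => a b; apply/eqP.
    by have := e a b; rewrite !mxE => /eqP; rewrite tofrac_eq.
  apply: inj; rewrite map_mxZ !map_mxM /=.
  set Fq := map_mx tf F; set Pq := map_mx tf Pc; set Qq := map_mx tf Qc.
  have Zq : map_mx tf Z = Pq *m Fq *m Qq by rewrite !map_mxM.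
  have Zu : map_mx tf Z \in unitmx.
    by rewrite unitmxE det_map_mx unitfE tofrac_eq0.
  have rPF : \rank (Pq *m Fq) = r.
    apply/eqP; rewrite eqn_leq rank_leq_row /=.
    have := mxrankM_maxl (Pq *m Fq) Qq.
    by rewrite -Zq (mxrank_unit Zu).
  have /submxP [Y FY] : (Fq <= Pq *m Fq)%MS.
    by rewrite -(mxrank_leqif_sup (submxMl Pq Fq)) rPF rkF.
  have -> : Fq *m Qq = Y *m map_mx tf Z by rewrite {1}FY Zq !mulmxA.
  rewrite -[Y *m _ *m _]mulmxA -map_mxM mul_mx_adj -/d map_scalar_mx.
  by rewrite mul_mx_scalar -scalemxAl -FY.
have [u ud] : exists u, horner_mx S u * horner_mx S d = 1.
  have : coprimep ('X ^+ q.+1) d.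
    rewrite coprimep_expl // -['X]subr0 -polyC0 coprimep_sym.
    by rewrite coprimep_XsubC rootE d0 oner_eq0.
  case/Bezout_eq1_coprimepP => -[v u] /= e; exists u.
  have hX : horner_mx S ('X ^+ q.+1) = 0.
    by apply: etrans (rmorphXn (horner_mx S) _ _) _; rewrite -[RHS]Sq; congr (_ ^+ _); exact: horner_mx_X.
  have := congr1 (horner_mx S) e; rewrite rmorphD rmorph1 /= !hornerM => <-.
  by rewrite [X in _ *m X + _](_ : _ = 0) ?mulmx0 ?add0r.
have -> : polymx_at F = (1%:M *t horner_mx S u) *m polymx_at (d *: F).
  have -> : d *: F = (d *: map_mx polyC 1%:M) *m F.
    by rewrite map_mx1 -scalemxAl mul1mx.
  rewrite polymx_atM polymx_atZ mulmxA tensmx_mul mulmx1.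
  rewrite (_ : _ *m horner_mx S d = 1%:M) ?tens1 ?mul1mx //.
rewrite fac polymx_atM mulmxA.
by apply: leq_trans (mxrankM_maxr _ _) _; exact: rank_leq_row.
Qed.

End PolyMatrixAt.

(** * Substituting a nilpotent operator for the parameter of a pencil *)

Lemma shift_mxX (K : fieldType) m (i j : 'I_m.+1) d :
  (shift_mx K m ^+ d) i j = (i == (j + d)%N :> nat)%:R.
Proof.
elim: d i => [|d IH] i; first by rewrite expr0 addn0 mxE.
rewrite exprS -mulmx_ring mxE addnS.
have [lt|ge] := ltnP (j + d) m.+1.
  rewrite (bigD1 (Ordinal lt)) //= big1 ?addr0 => [|c ne].
    by rewrite IH !mxE eqxx mulr1.
  rewrite IH; case: eqP => [e|]; rewrite ?mulr0 //.
  by case/eqP: ne; apply: val_inj.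
rewrite big1 => [|c _]; first by rewrite ltn_eqF //; have := ltn_ord i; lia.
by rewrite IH ltn_eqF ?mulr0 //; have := ltn_ord c; lia.
Qed.

Lemma shift_mx_nil (K : fieldType) m : shift_mx K m ^+ m.+1 = 0.
Proof.
apply/matrixP => i j; rewrite shift_mxX mxE ltn_eqF //.
by have := ltn_ord i; lia.
Qed.

Lemma rank_shift_top (K : fieldType) m : \rank (shift_mx K m ^+ m) = 1%N.
Proof.
have -> : shift_mx K m ^+ m = delta_mx ord_max ord0.
  apply/matrixP => i j; rewrite shift_mxX mxE; congr (_%:R).
  rewrite -!val_eqE /=; congr nat_of_bool; have := ltn_ord i; have := ltn_ord j; lia.
exact: mxrank_delta.
Qed.

(** Every term of the expansion other than [X ^+ j] carries a factor [S]. *)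
Lemma exprD_top (R : pzRingType) (X W S : R) m j :
  GRing.comm X S -> GRing.comm W S -> GRing.comm W X -> S ^+ m.+1 = 0 ->
  (X + W * S) ^+ j * S ^+ m = X ^+ j * S ^+ m.
Proof.
move=> XS WS WX Sm; elim: j => [|j IH]; first by rewrite !expr0.
rewrite exprS -mulrA IH mulrDl mulrA -exprS -mulrA.
have -> : S * (X ^+ j * S ^+ m) = X ^+ j * S ^+ m.+1.
  by rewrite exprS !mulrA; congr (_ * _); apply: commrX; exact: commr_sym.
by rewrite Sm !mulr0 addr0.
Qed.

Section Translation.
Variables (K : fieldType) (N m : nat) (B : 'M[K]_N).
Local Notation q := m.+1.
Local Notation S := (1%:M *t shift_mx K m : 'M_(N * q)).
Local Notation Bh := (B *t 1%:M : 'M_(N * q)).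

Let T := S + Bh.
Let e00 : 'M[K]_(N * q) := 1%:M *t delta_mx ord0 ord0.
Let theta : 'M[K]_(N * q) := 1%:M *t delta_mx ord0 ord_max.

(** The substitution [s |-> s + B] on [K^N (x) K[s]/s^m.+1]: the vector
    [v (x) s^i] goes to [(s + B)^i (v (x) 1)]. *)
Definition translation : 'M[K]_(N * q) :=
  \sum_(i < q) T ^+ i * theta * S ^+ (m - i).

Let SX j : S ^+ j = 1%:M *t shift_mx K m ^+ j.
Proof. by rewrite tensX; congr (_ *t _); rewrite mx1_ring expr1n. Qed.

Lemma translationE : T ^+ q = 0 -> T * translation = translation * S.
Proof.
move=> Tq; rewrite /translation mulr_sumr mulr_suml.
rewrite big_ord_recr [RHS]big_ord_recl /= subnn expr0 mulr1.
rewrite mulrA -exprS Tq mul0r addr0 subn0 expr0 mul1r -mulrA -exprSr.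
rewrite SX shift_mx_nil tensmx0 mulr0 add0r; apply: eq_bigr => i _.
rewrite !mulrA -exprS -[RHS]mulrA -exprSr; congr (_ * _ ^+ _).
by rewrite /bump leq0n add1n subnSK.
Qed.

Lemma translation_comm (A : 'M[K]_N) : GRing.comm A B ->
  GRing.comm (A *t 1%:M) translation.
Proof.
move=> AB; have c1 (C : 'M[K]_q) : GRing.comm (A *t 1%:M) (1%:M *t C).
  by rewrite /GRing.comm -!mulmx_ring !tensmx_mul !mulmx1 !mul1mx.
apply: commr_sum => i _; apply: commrM; first apply: commrM.
- apply: commrX; apply: commrD; first exact: c1.
  by rewrite /GRing.comm -!mulmx_ring !tensmx_mul !mulmx1 !mulmx_ring AB.
- exact: c1.
- by rewrite SX; exact: c1.
Qed.

(** Its left kernel is stable under the nilpotent [T].  A vector [y] of the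
    kernel with [y T = 0] has no component in degree [0] and satisfies
    [y S = - y B], so all its components vanish. *)
Lemma translation_unit : T ^+ q = 0 -> translation \in unitmx.
Proof.
move=> Tq; rewrite -row_free_unit -kermx_eq0; apply/rowV0P => x /sub_kermxP.
have ST := translationE Tq.
have top (y : 'rV_(N * q)) : y *m translation = 0 -> y *m T = 0 -> y = 0.
  move=> y0 yT.
  have ye : y *m e00 = 0.
    rewrite -y0 /translation mulmx_sumr (bigD1 ord0) //= big1 ?addr0 => [|i].
      rewrite expr0 mul1r subn0 SX -mulmx_ring tensmx_mul mulmx1.
      congr (_ *m (_ *t _)); apply/matrixP => i j; rewrite !mxE.
      rewrite (bigD1 ord_max) //= big1 ?addr0 => [|c ne]; last first.
        by rewrite mxE (negPf ne) andbF mul0r.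
      rewrite !mxE eqxx andbT shift_mxX /= -natrM mulnb; congr (_%:R).
      by congr (nat_of_bool (_ && _)); rewrite -val_eqE /=; have := ltn_ord j; lia.
    case: i => -[|i] //= lt _.
    by rewrite exprS -!mulmx_ring !mulmxA yT !mul0mx.
  have yS : y *m S = - (y *m Bh).
    by apply/eqP; rewrite -addr_eq0 -mulmxDr yT.
  have Be : Bh *m e00 = e00 *m Bh by rewrite !tensmx_mul !mulmx1 !mul1mx.
  have BS : Bh *m S = S *m Bh by rewrite !tensmx_mul !mulmx1 !mul1mx.
  have ySe i : y *m (S ^+ i) *m e00 = 0.
    suff [z] : exists z : 'M_(N * q), y *m S ^+ i *m e00 = y *m e00 *m z.
      by rewrite ye mul0mx.
    exists ((- Bh) ^+ i); elim: i => [|i IH]; first by rewrite !expr0 !mulmx1.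
    rewrite exprS -mulmx_ring mulmxA yS mulNmx -[y *m Bh *m _]mulmxA.
    rewrite [Bh *m _](_ : _ = S ^+ i *m Bh); last first.
      by apply: (@commrX 'M[K]_(N * q)).
    rewrite mulmxA mulNmx -[_ *m Bh *m e00]mulmxA Be mulmxA IH.
    by rewrite exprSr -mulmx_ring !mulmxA mulmxN.
  rewrite -[y]mulmx1 -(tens1 _ N q).
  have -> : (1%:M : 'M[K]_q) = \sum_(i < q) shift_mx K m ^+ i *m delta_mx ord0 i.
    apply/matrixP => a b; rewrite mxE summxE (bigD1 b) //= big1 ?addr0.
      rewrite mxE (bigD1 ord0) //= big1 ?addr0 => [|c ne]; last first.
        by rewrite [delta_mx _ _ _ _]mxE (negPf ne) mulr0.
      by rewrite shift_mxX mxE !eqxx mulr1 add0n.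
    move=> c ne; rewrite mxE big1 // => d _.
    by rewrite [delta_mx _ _ _ _]mxE [b == c]eq_sym (negPf ne) andbF mulr0.
  have -> : (1%:M : 'M[K]_N) *t (\sum_(i < q) shift_mx K m ^+ i *m delta_mx ord0 i)
      = \sum_(i < q) S ^+ i *m e00 *m (1%:M *t delta_mx ord0 i).
    rewrite tens_sumr; apply: eq_bigr => i _.
    by rewrite SX !tensmx_mul !mul1mx -mulmxA mul_delta_mx.
  rewrite mulmx_sumr big1 // => i _.
  by rewrite !mulmxA ySe mul0mx.
move=> x0; have ex : exists k, x *m T ^+ k == 0 by exists q; rewrite Tq mulmx0.
case: (ex_minnP ex) => -[|k] /eqP xk min; first by rewrite -xk expr0 mulmx1.
have := top (x *m T ^+ k); rewrite -!mulmxA [T ^+ k *m T](esym (exprSr _ _)) xk => xk0.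
suff z : x *m (T ^+ k *m translation) = 0.
  by have /eqP/min := xk0 z erefl; rewrite ltnn.
have -> : T ^+ k *m translation = translation *m S ^+ k.
  by rewrite -(intertwineX k (esym ST)).
by rewrite mulmxA x0 mul0mx.
Qed.

End Translation.

Definition ratC (K : fieldType) : {rmorphism K -> {fraction {poly K}}} :=
  @tofrac _ \o polyC.

Definition rat_pencil (K : fieldType) n (X Xi : 'M[K]_n) :
    'M[{fraction {poly K}}]_n :=
  map_mx (ratC K) X + tofrac 'X *: map_mx (ratC K) Xi.

Lemma map_mxX (R S : pzRingType) (f : {rmorphism R -> S}) n (X : 'M[R]_n) j :
  map_mx f (X ^+ j) = map_mx f X ^+ j.
Proof.
elim: j => [|j IH]; first by rewrite !expr0 -!mx1_ring map_mx1.
by rewrite !exprS -IH -!mulmx_ring map_mxM.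
Qed.

(** A compression that is invertible at [s = 0] is invertible over [K(s)]. *)
Lemma rank_specialize (K : fieldType) n (F : 'M[{poly K}]_n) :
  (\rank (map_mx (horner_eval 0%R) F) <= \rank (map_mx (@tofrac _) F))%N.
Proof.
have [P [Q]] := compression_at0 F; set Z := _ *m _ => d0.
have dN0 : \det Z != 0.
  by apply: contra_eq_neq d0 => ->; rewrite horner0 eq_sym oner_eq0.
have Zu : map_mx (@tofrac _) Z \in unitmx.
  by rewrite unitmxE det_map_mx unitfE tofrac_eq0.
have := mxrank_unit Zu; rewrite !map_mxM /= => <-.
exact: leq_trans (mxrankM_maxl _ _) (mxrankM_maxr _ _).
Qed.

Lemma rank_rat_pencil (K : fieldType) n (X Xi : 'M[K]_n) j :
  (\rank (X ^+ j) <= \rank (rat_pencil X Xi ^+ j))%N.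
Proof.
pose F : 'M[{poly K}]_n := map_mx polyC X + 'X *: map_mx polyC Xi.
have F0 : map_mx (horner_eval 0) F = X.
  apply/matrixP => a b.
  by rewrite !mxE /= horner_evalE hornerD hornerM !hornerC hornerX mul0r addr0.
have FE : map_mx (@tofrac _) F = rat_pencil X Xi.
  by rewrite map_mxD map_mxZ -!map_mx_comp.
by have := rank_specialize (F ^+ j); rewrite !map_mxX FE F0.
Qed.

Lemma rank_convexX (K : fieldType) n (Y S : 'M[K]_n) a : GRing.comm S Y ->
  (2 * \rank (Y *m S ^+ a.+1) <= \rank (Y *m S ^+ a) + \rank (Y *m S ^+ a.+2))%N.
Proof.
move=> c; rewrite !exprSr -!mulmx_ring !mulmxA; apply: rank_convex.
by apply: commrM => //; exact: commrX.
Qed.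

(** [K^N (x) K[s]/s^Q] carries the two operators [Y], given by [(X + s Xi)^j],
    and [Y'], its translate under [s |-> s + B].  The ranks of [Y s^a] are
    linear in [a] because the pencil has constant rank near [s = 0].  Translation
    by [B] fixes [s^q] when [q] is a power of [p] with [B^q = 0], so [Y' s^a] has
    the same rank for [a] in [{0, Q - q, Q}], where [Q = p q].  By convexity it
    has the same rank for [a = Q - 1], that is, at [s = 0]. *)
Lemma rank_pencil_nilpotent (K : fieldType) p N (X Xi B : 'M[K]_N) e j :
  p \in [pchar K] -> GRing.comm X Xi -> GRing.comm X B -> GRing.comm Xi B ->
  B ^+ e = 0 ->
  \rank (rat_pencil X Xi ^+ j) = \rank (X ^+ j) ->
  \rank ((X + (Xi * B)%R) ^+ j) = \rank (X ^+ j).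
Proof.
move=> pK XXi XB XiB Be rkX; have p_gt1 : (1 < p)%N := prime_gt1 (pcharf_prime pK).
pose q := (p ^ e.+1)%N.
have qe : (e < q)%N by apply: leq_trans (ltn_expl e p_gt1) _; rewrite leq_pexp2l // ltnW.
have Bq : B ^+ q = 0 by rewrite -(subnK (ltnW qe)) exprD Be mulr0.
pose m := (p * q).-1; have mE : (m.+1 = p * q)%N by rewrite prednK //; nia.
pose S : 'M[K]_(N * m.+1) := 1%:M *t shift_mx K m.
pose Xh : 'M[K]_(N * m.+1) := X *t 1%:M.
pose Xih : 'M[K]_(N * m.+1) := Xi *t 1%:M.
pose Bh : 'M[K]_(N * m.+1) := B *t 1%:M.
have SX i : S ^+ i = 1%:M *t shift_mx K m ^+ i.
  by rewrite tensX; congr (_ *t _); rewrite mx1_ring expr1n.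
have hM (A C : 'M[K]_N) : (A *t 1%:M : 'M_(N * m.+1)) * (C *t 1%:M) = (A * C) *t 1%:M.
  by rewrite -!mulmx_ring tensmx_mul mulmx1.
have hX (A : 'M[K]_N) i : (A *t 1%:M : 'M_(N * m.+1)) ^+ i = A ^+ i *t 1%:M.
  by rewrite tensX; congr (_ *t _); rewrite mx1_ring expr1n.
have hS (A : 'M[K]_N) : GRing.comm (A *t 1%:M) S.
  by rewrite /GRing.comm -!mulmx_ring !tensmx_mul !mulmx1 !mul1mx.
have hC (A C : 'M[K]_N) : GRing.comm A C ->
    GRing.comm (A *t 1%:M : 'M_(N * m.+1)) (C *t 1%:M).
  by rewrite /GRing.comm !hM => ->.
have Sm : S ^+ m.+1 = 0 by rewrite SX shift_mx_nil tensmx0.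
pose T := S + Bh; pose r := \rank (X ^+ j).
pose Y := (Xh + Xih * S) ^+ j; pose Y' := (Xh + Xih * T) ^+ j.
have YS : GRing.comm S Y.
  apply/commrX/commrD; first exact/commr_sym/hS.
  by apply: commrM => //; exact/commr_sym/hS.
have TS : GRing.comm S T by apply: commrD => //; exact/commr_sym/hS.
have YS' : GRing.comm S Y'.
  apply/commrX/commrD; first exact/commr_sym/hS.
  by apply: commrM => //; exact/commr_sym/hS.
have Tq : T ^+ q = S ^+ q.
  rewrite (exprD_pchar_comm _ pK); last exact/commr_sym/hS.
  by rewrite hX Bq tens0mx addr0.
have Tm : T ^+ m.+1 = 0.
  rewrite (congr1 (fun k => T ^+ k) mE) (mulnC p q) exprM Tq -exprM (mulnC q p).
  by rewrite -(congr1 (fun k => S ^+ k) mE).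
have gtop : \rank (Y *m S ^+ m) = r.
  rewrite mulmx_ring exprD_top //; [|exact: hS|exact: hS|exact/hC/commr_sym].
  by rewrite hX SX -mulmx_ring tensmx_mul mul1mx mulmx1 rank_tens rank_shift_top muln1.
have g0 : (\rank Y <= r * m.+1)%N.
  pose F : 'M[{poly K}]_N := (map_mx polyC X + 'X *: map_mx polyC Xi) ^+ j.
  have YF : Y = polymx_at (shift_mx K m) F.
    rewrite polymx_atX polymx_atD polymx_atC polymx_atZ horner_mx_X.
    by congr ((_ + _) ^+ _); rewrite -mulmx_ring tensmx_mul mulmx1 mul1mx.
  have F0 : map_mx (horner_eval 0) F = X ^+ j.
    rewrite map_mxX; congr (_ ^+ _); apply/matrixP => a b.
    by rewrite !mxE /= horner_evalE hornerD hornerM !hornerC hornerX mul0r addr0.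
  rewrite YF; apply: leq_trans (rank_polymx_at (shift_mx_nil K m) _) _.
    rewrite F0 -rkX map_mxX; congr (\rank (_ ^+ _)).
    by rewrite map_mxD map_mxZ -!map_mx_comp.
  by rewrite F0.
have gE a : (a <= m + 1)%N -> \rank (Y *m S ^+ a) = (r * (m + 1 - a))%N.
  apply: (@convex_linear (fun a => \rank (Y *m S ^+ a)) r m 1) => //.
  - by move=> b; exact: rank_convexX.
  - by rewrite -ltnS mE; nia.
  - by rewrite expr0 mulmx1 addn1.
  - by rewrite gtop muln1.
  - by rewrite addn1 Sm mulmx0 mxrank0.
have agree a : \rank (Y' *m S ^+ (q * a)) = \rank (Y *m S ^+ (q * a)).
  pose U := translation m B.
  have Uu : U \in unitmx by apply: translation_unit.
  have TU : T * U = U * S by apply: translationE.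
  have hU (A : 'M[K]_N) : GRing.comm A B -> GRing.comm (A *t 1%:M) U.
    exact: translation_comm.
  have YU : (Y' *m S ^+ (q * a)) *m U = U *m (Y *m S ^+ (q * a)).
    have YU1 : U *m Y = Y' *m U.
      apply: intertwineX; rewrite mulmxDr mulmxDl; congr (_ + _).
        exact/esym/hU.
      rewrite !mulmx_ring mulrA -(hU Xi) // -!mulrA; congr (_ * _).
      exact/esym.
    have TUa : U *m S ^+ (q * a) = T ^+ (q * a) *m U by exact/intertwineX/esym.
    rewrite mulmxA YU1 -[RHS]mulmxA TUa [T ^+ _]exprM Tq -exprM.
    by rewrite mulmxA.
  rewrite -(mxrankMfree _ (B := U)) ?row_free_unit // YU.
  by rewrite eqmxMfull // row_full_unit.
have g'E a : (a <= (p * q - q) + q)%N ->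
    \rank (Y' *m S ^+ a) = (r * (p * q - q + q - a))%N.
  have pqE : (p * q - q + q = p * q)%N by nia.
  apply: (@convex_linear (fun a => \rank (Y' *m S ^+ a)) r).
  - by move=> b; exact: rank_convexX.
  - nia.
  - nia.
  - by have := agree 0%N; rewrite muln0 => ->; rewrite gE ?addn1 ?mE ?subn0 ?pqE.
  - have -> : (p * q - q = q * (p - 1))%N by rewrite mulnBr muln1 mulnC.
    rewrite agree gE ?addn1 ?mE; first by congr (_ * _)%N; nia.
    by nia.
  - by rewrite pqE -mE Sm mulmx0 mxrank0.
have := g'E m; rewrite (_ : p * q - q + q - m = 1)%N ?muln1; last by nia.
move=> gm; rewrite -/r -gm; last by nia.
rewrite mulmx_ring /Y' mulrDr [_ * S + _]addrC addrA exprD_top //.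
- rewrite hM -[X *t _ + _](_ : (X + Xi * B) *t 1%:M = _); last first.
    by apply/matrixP => u v; rewrite !mxE mulrDl.
  set Z := X + Xi * B; by rewrite hX SX -mulmx_ring tensmx_mul mul1mx mulmx1 rank_tens rank_shift_top muln1.
- apply: commr_sym; apply: commrD; first exact/commr_sym/hS.
  by apply: commrM; exact/commr_sym/hS.
- exact: hS.
- apply: commrD; first exact/hC/commr_sym.
  by rewrite hM; apply: hC; apply: commrM.
Qed.

(** Several nilpotent substitutions at once.  [PP] is any class of commuting
    families [(X, Xi_1, ..., Xi_n)] over varying fields that is closed under
    moving [X] generically in the direction [Xi_1] and then forgetting
    [Xi_1].  If the ranks of the powers of [X] are the same throughout the class
    then they do not change when nilpotent multiples of the [Xi_i] are added. *)
Lemma rank_class_nilpotent (p N : nat) (r : nat -> nat)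
    (PP : forall K : fieldType, 'M[K]_N -> seq 'M[K]_N -> Prop) :
  (forall K X l, PP K X l -> forall j, \rank (X ^+ j) = r j) ->
  (forall K X Xi l, PP K X (Xi :: l) -> PP K X l) ->
  (forall K X Xi l, PP K X (Xi :: l) ->
     PP {fraction {poly K}} (rat_pencil X Xi) (map (map_mx (ratC K)) l)) ->
  forall (K : fieldType) (X : 'M[K]_N) (l : seq ('M[K]_N * 'M[K]_N)),
  p \in [pchar K] -> PP K X (unzip1 l) ->
  {in X :: unzip1 l ++ unzip2 l &, forall Y Z, GRing.comm Y Z} ->
  (forall B, B \in unzip2 l -> exists e, B ^+ e = 0) ->
  forall j, \rank ((X + \sum_(u <- l) (u.1 * u.2)%R) ^+ j) = r j.
Proof.
move=> PPr PPf PPg K X l; move sz: (size l) => n.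
elim: n K X l sz => [|n IH] K X [|[Xi B] l] // sz pK PX cm nil j.
  by rewrite big_nil addr0; exact: PPr PX j.
have {}sz : size l = n by case: sz.
have cm' Y Z : Y \in [:: X, Xi, B & unzip1 l ++ unzip2 l] ->
    Z \in [:: X, Xi, B & unzip1 l ++ unzip2 l] -> GRing.comm Y Z.
  have sub W : W \in [:: X, Xi, B & unzip1 l ++ unzip2 l] ->
      W \in X :: unzip1 ((Xi, B) :: l) ++ unzip2 ((Xi, B) :: l).
    rewrite /= !(inE, mem_cat).
    by case: (W == X) (W == Xi) (W == B) (W \in unzip1 l) => -[] [] [].
  by move=> /sub + /sub; exact: cm.
have inl Y : Y \in X :: unzip1 l ++ unzip2 l ->
    Y \in [:: X, Xi, B & unzip1 l ++ unzip2 l].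
  by rewrite !inE => /orP[->|->]; rewrite ?orbT.
rewrite big_cons /= [X in _ + X]addrC addrA.
set X' := X + _.
have X'comm Y : (forall Z, Z \in X :: unzip1 l ++ unzip2 l -> GRing.comm Y Z) ->
    GRing.comm Y X'.
  move=> cY; apply: commrD; first by apply: cY; rewrite mem_head.
  rewrite big_seq; apply: commr_sum => u ul; apply: commrM; apply: cY.
    by rewrite inE mem_cat (map_f fst ul) orbT.
  by rewrite inE mem_cat (map_f snd ul) !orbT.
have rX' i : \rank (X' ^+ i) = r i.
  apply: IH => //; first exact: PPf PX.
    by move=> Y Z /inl Yl /inl Zl; exact: cm'.
  by move=> C Cl; apply: nil; rewrite inE Cl orbT.
have [e Be] : exists e, B ^+ e = 0 by apply: nil; rewrite mem_head.
rewrite (@rank_pencil_nilpotent K p N X' Xi B e j) //.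
- by apply/commr_sym/X'comm => Z /inl; apply: cm'; rewrite !inE eqxx orbT.
- by apply/commr_sym/X'comm => Z /inl; apply: cm'; rewrite !inE eqxx !orbT.
- by apply: cm'; rewrite !inE eqxx ?orbT.
pose f := map_mx (ratC K) : 'M_N -> 'M_N.
pose l' := [seq (f u.1, f u.2) | u <- l].
have l1 : unzip1 l' = map f (unzip1 l) by rewrite /unzip1 -!map_comp.
have l2 : unzip2 l' = map f (unzip2 l) by rewrite /unzip2 -!map_comp.
have fM Y Z : f (Y * Z) = f Y * f Z by exact: map_mxM.
rewrite rX'.
have -> : rat_pencil X' Xi = rat_pencil X Xi + \sum_(u <- l') u.1 * u.2.
  rewrite /rat_pencil /X' map_mxD -!addrA; congr (_ + _); rewrite addrC.
  congr (_ + _); rewrite raddf_sum big_map; apply: eq_bigr => u _.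
  exact: fM.
apply: IH.
- by rewrite size_map.
- exact: rmorph_pchar (ratC K) _ pK.
- by rewrite l1; apply: PPg PX.
- have cf Y Z : GRing.comm Y Z -> GRing.comm (f Y) (f Z).
    by rewrite /GRing.comm -!fM => ->.
  have cp Y : Y \in unzip1 l ++ unzip2 l -> GRing.comm (f Y) (rat_pencil X Xi).
    move=> Yl; apply: commrD.
      by apply: cf; apply: cm'; rewrite !inE ?Yl ?eqxx ?orbT.
    rewrite /GRing.comm -!mulmx_ring -scalemxAl -scalemxAr; congr (_ *: _).
    by apply: cf; apply: cm'; rewrite !inE ?Yl ?eqxx ?orbT.
  rewrite l1 l2 -map_cat => Y Z; rewrite !inE.
  move=> /orP[/eqP->|/mapP[Y' Yl ->]] /orP[/eqP->|/mapP[Z' Zl ->]] //.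
  + exact/commr_sym/cp.
  + exact: cp.
  + by apply: cf; apply: cm'; rewrite !inE ?Yl ?Zl !orbT.
- move=> C; rewrite l2 => /mapP[C' Cl ->].
  have [|d Cd] := nil C'; first by rewrite inE Cl orbT.
  by exists d; rewrite /f -map_mxX Cd map_mx0.
Qed.

(** * Left multiplication on the group algebra *)

Section LeftMult.
Variables (K : fieldType) (H : finGroupScheme K).
Local Notation n := (gs_order H).

(** Acting on row vectors, hence contravariant in [x]. *)
Definition lmx (x : grpalg H) : 'M[K]_n :=
  \matrix_(j, l) \sum_i gs_comul H l i j * x 0 i.

Lemma mul_lmx (x y : grpalg H) : (y : 'rV_n) *m lmx x = x * y.
Proof.
apply/rowP => l; rewrite [RHS]grpalg_mulE mxE exchange_big /=.
apply: eq_bigr => j _; rewrite mxE mulr_sumr; apply: eq_bigr => i _.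
by rewrite mulrCA [y 0 j * _]mulrC.
Qed.

Lemma lmxP (x : grpalg H) (A : 'M_n) :
  (forall y : grpalg H, (y : 'rV_n) *m A = x * y) -> A = lmx x.
Proof. by move=> h; apply/row_matrixP => i; rewrite !rowE h mul_lmx. Qed.

Lemma lmx_linear : linear lmx.
Proof.
move=> c x y; apply/esym/lmxP => z.
rewrite mulmxDr -scalemxAr !mul_lmx mulrDl; congr (_ + _); exact: grpalg_scalel.
Qed.

HB.instance Definition _ :=
  GRing.isLinear.Build K (grpalg H) 'M[K]_n _ lmx lmx_linear.

Lemma lmx1 : lmx 1 = 1%:M.
Proof. by apply/esym/lmxP => y; rewrite mulmx1 mul1r. Qed.

Lemma lmxM x y : lmx (x * y) = lmx y *m lmx x.
Proof. by apply/esym/lmxP => z; rewrite mulmxA !mul_lmx mulrA. Qed.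

Lemma lmxX x j : lmx (x ^+ j) = lmx x ^+ j.
Proof.
elim: j => [|j IH]; first by rewrite !expr0 lmx1.
by rewrite exprSr exprS lmxM IH.
Qed.

Lemma lmx_inj : injective lmx.
Proof. by move=> x y e; rewrite -[x]mulr1 -[y]mulr1 -!mul_lmx e. Qed.

End LeftMult.

(** * Flatness over [K[t]/t^p] *)

(** Exactness bounds the first loss of rank, [n - \rank U], by the last one,
    [\rank (U ^+ p.-1)]; by convexity it bounds all [p] of them. *)
Lemma rank_of_exact (K : fieldType) n p (U : 'M[K]_n) :
  (0 < p)%N -> U ^+ p = 0 -> (kermx (U ^+ p.-1) <= U)%MS ->
  (n <= p * \rank (U ^+ p.-1))%N.
Proof.
move=> p0 Up /mxrankS; rewrite mxrank_ker; set d := \rank (U ^+ p.-1) => le.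
pose g j := \rank (U ^+ j).
have cvx j : (2 * g j.+1 <= g j + g j.+2)%N := rankX_convex U j.
have g0 : g 0%N = n by rewrite /g expr0 mxrank1.
have g1 : (n <= g 1%N + d)%N by rewrite /g expr1 addnC -leq_subLR.
have st j : (g j <= g j.+1 + d)%N.
  by elim: j => [|j IH]; [rewrite g0|have := cvx j; lia].
have lo j : (n <= g j + j * d)%N.
  elim: j => [|j IH]; first by rewrite g0 leq_addr.
  by have := st j; rewrite mulSn; lia.
by have := lo p; rewrite /g Up mxrank0.
Qed.

Lemma relative_trace_comm (K : fieldType) n q (U Th : 'M[K]_n) :
  U ^+ q.+1 = 0 ->
  U *m (\sum_(i < q.+1) U ^+ (q - i) *m Th *m U ^+ i)
  = (\sum_(i < q.+1) U ^+ (q - i) *m Th *m U ^+ i) *m U.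
Proof.
move=> Up; rewrite mulmx_sumr mulmx_suml big_ord_recl [RHS]big_ord_recr /=.
rewrite subn0 subnn expr0 mulmx1 mulmxA [U *m U ^+ q](esym (exprS _ _)) Up mul0mx.
rewrite -[1 *m Th *m _ *m U]mulmxA [U ^+ q *m U](esym (exprSr _ _)) Up mulmx0.
rewrite add0r addr0; apply: eq_bigr => i _.
rewrite -[RHS]mulmxA [U ^+ i *m U](esym (exprSr _ _)) !mulmxA.
by rewrite [U *m _](esym (exprS _ _)) /bump leq0n add1n subnSK.
Qed.

(** Higman's criterion: when [K^n] is free over [K[U]/U^p] the identity is a
    relative trace [\sum_i U^(p-1-i) Theta U^i].  A generalized inverse of
    [U^(p-1)] has a trace that is the identity on the socle, hence
    invertible. *)
Lemma higman (K : fieldType) n p (U : 'M[K]_n) :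
  (0 < p)%N -> U ^+ p = 0 -> (n <= p * \rank (U ^+ p.-1))%N ->
  exists Theta : 'M_n, \sum_(i < p) U ^+ (p.-1 - i) *m Theta *m U ^+ i = 1%:M.
Proof.
move=> p0 Up le; have rk := free_rank p0 Up le.
have UpE : U ^+ p.-1.+1 = 0 by rewrite prednK.
pose Th := pinvmx (U ^+ p.-1).
pose Z := \sum_(i < p) U ^+ (p.-1 - i) *m Th *m U ^+ i.
have ZU : U *m Z = Z *m U.
  have := relative_trace_comm Th UpE; rewrite /Z; case: (p) p0 => //.
have Zu : Z \in unitmx.
  rewrite -row_free_unit -kermx_eq0; apply/rowV0P => x /sub_kermxP xZ.
  have ex : exists k, x *m U ^+ k == 0 by exists p; rewrite Up mulmx0.
  case: (ex_minnP ex) => -[|k] /eqP xk min; first by rewrite -xk expr0 mulmx1.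
  suff /eqP/min : x *m U ^+ k = 0 by rewrite ltnn.
  set y := x *m U ^+ k.
  have yU : y *m U = 0 by rewrite /y -mulmxA [U ^+ k *m U](esym (exprSr _ _)).
  have yZ : y *m Z = 0.
    by rewrite /y -mulmxA -(intertwineX k (esym ZU)) mulmxA xZ mul0mx.
  have /submxP [w yw] : (y <= U ^+ p.-1)%MS.
    have yk : (y <= kermx U)%MS by apply/sub_kermxP.
    apply: submx_trans yk _.
    have sub : (U ^+ p.-1 <= kermx U)%MS.
      by apply/sub_kermxP; rewrite [_ *m U](esym (exprSr _ _)).
    rewrite -(mxrank_leqif_sup sub) mxrank_ker -[U in (n - \rank U)%N]expr1.
    have := rk 0%N; have := rk 1%N; rewrite expr0 mxrank1 subn0 => ->.
    move: (\rank _) => d nE; apply/eqP; rewrite [n in (n - _)%N]nE.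
    by rewrite -mulnBl subKn // mul1n.
  rewrite -yZ yw /Z mulmx_sumr.
  have lt : (p.-1 < p)%N by rewrite prednK.
  rewrite (bigD1 (Ordinal lt)) //= big1 ?addr0 => [|i ne].
    have key : U ^+ p.-1 *m Th *m U ^+ p.-1 = U ^+ p.-1 by exact: mulmxKpV.
    by rewrite subnn expr0 [1 *m _]mul1mx -mulmxA (mulmxA (U ^+ _)) key.
  have [k' e] : exists k', (p.-1 - i = k'.+1)%N.
    exists (p.-1 - i).-1; rewrite prednK // subn_gt0.
    by move: ne; rewrite -val_eqE /=; have := ltn_ord i; lia.
  rewrite e !mulmxA -[w *m _ *m _]mulmxA [_ *m U ^+ k'.+1](esym (exprD _ _ _)).
  by rewrite addnS -addSn exprD UpE mul0r mulmx0 !mul0mx.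
have ZVU : invmx Z *m U = U *m invmx Z.
  apply: (can_inj (mulmxK Zu)).
  by rewrite -!mulmxA ZU mulVmx // mulmx1 mulmxA mulVmx // mul1mx.
exists (Th *m invmx Z).
transitivity (\sum_(i < p) (U ^+ (p.-1 - i) *m Th *m U ^+ i) *m invmx Z).
  by apply: eq_bigr => i _; rewrite -!mulmxA (intertwineX i ZVU).
by rewrite -mulmx_suml mulmxV.
Qed.

(** The residue field of [K[t]/t^p.+1], as a module. *)
Definition residue (K : fieldType) (p : nat) : Type := K.

Section Residue.
Variables (K : fieldType) (p : nat).
Local Notation R := (truncpoly K p.+1).
Local Notation t := ('qX : R).

HB.instance Definition _ := GRing.Zmodule.on (residue K p).

Definition residue_scale (r : R) (c : residue K p) : residue K p :=
  (r`_0 * (c : K) : K).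

Fact residue_scaleA r s c :
  residue_scale r (residue_scale s c) = residue_scale (r * s) c.
Proof.
by rewrite /residue_scale coef_truncpolyM // big_ord1 /= mulrA.
Qed.

Fact residue_scale1 : left_id 1 residue_scale.
Proof. by move=> c; rewrite /residue_scale /= coefC mul1r. Qed.

Fact residue_scaleDr : right_distributive residue_scale +%R.
Proof. by move=> r c d; rewrite /residue_scale mulrDr. Qed.

Fact residue_scaleDl c : {morph residue_scale^~ c : r s / r + s}.
Proof. by move=> r s; rewrite /residue_scale coefD mulrDl. Qed.

HB.instance Definition _ := GRing.Zmodule_isLmodule.Build R (residue K p)
  residue_scaleA residue_scale1 residue_scaleDr residue_scaleDl.

Definition to_socle (c : residue K p) : R^o := (c : K) *: t ^+ p.

Fact to_socle_linear : linear to_socle.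
Proof.
move=> r c d; rewrite /to_socle scalerDl; congr (_ + _).
change (((r`_0 : K) * c) *: t ^+ p = r * (c *: t ^+ p)).
rewrite -scalerAr {2}[r]truncpoly_sum // mulr_suml big_ord_recl big1 => [|i _].
  by rewrite addr0 expr0 -scalerAl mul1r scalerA mulrC.
by rewrite -scalerAl -exprD lift0 addSnnS exprD qXp0 // mulr0 scaler0.
Qed.

HB.instance Definition _ :=
  GRing.isLinear.Build R (residue K p) R^o _ to_socle to_socle_linear.

Lemma to_socle_inj : injective to_socle.
Proof.
move=> c d /(congr1 (fun r : R => r`_p)).
by rewrite /to_socle !coefZ coef_qXn // eqxx !mulr1.
Qed.

End Residue.

Section Flat.
Variables (K : fieldType) (p' : nat) (H : finGroupScheme K).
Local Notation p := p'.+1.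
Local Notation R := (truncpoly K p).
Local Notation t := ('qX : R).
Local Notation S := (grpalg H).
Local Notation n := (gs_order H).
Variable alpha : {lrmorphism R -> S}.
Let u := alpha t.
Let U := lmx u.

Let alphaE r : alpha r = \sum_(i < p) r`_i *: u ^+ i.
Proof.
rewrite {1}[r]truncpoly_sum // linear_sum; apply: eq_bigr => i _.
apply: etrans (linearZ_LR alpha _ _) _; congr (_ *: _); exact: rmorphXn.
Qed.

Let u_nil : u ^+ p = 0.
Proof. by rewrite -rmorphXn qXp0 // rmorph0. Qed.

Let U_nil : U ^+ p = 0.
Proof. by rewrite -lmxX u_nil linear0. Qed.

(** Flatness is applied to the inclusion of the socle of [K[t]/t^p]; the
    vanishing of [1 (x) x] in [K (x) S = S / u S] is detected by a cokernel. *)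
Lemma flat_rank : left_flat alpha -> (n <= p * \rank (U ^+ p'))%N.
Proof.
move=> flat; apply: rank_of_exact => //=.
set A := kermx _; suff sub i : (row i A <= U)%MS by apply/row_subP.
pose x : S := row i A.
have ux : u ^+ p' * x = 0.
  by rewrite -mul_lmx lmxX /x -row_mul mulmx_ker row0.
have inj := @flat _ _ (@to_socle K p') (@to_socle_inj K p') [:: (1 : K, x)].
have {}inj : tensor_eq0 alpha [:: (1 : residue K p', x)].
  apply: inj => T phi phiDl phiDr phiB; rewrite big_seq1 /= /to_socle scale1r.
  have -> : t ^+ p' = t ^+ p' *: (1 : R^o) by rewrite -[RHS]/(t ^+ p' * 1) mulr1.
  rewrite phiB rmorphXn -/u ux.
  by apply: (@addrI _ (phi 1 0)); rewrite -phiDr !addr0.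
pose phi (c : residue K p') (y : S) : 'rV[K]_n := (c : K) *: (y *m cokermx U).
have UC : U *m cokermx U = 0 by rewrite mulmx_coker.
have := inj _ phi; rewrite big_seq1 /phi /= scale1r submxE => -> //.
- by move=> c d y; rewrite -scalerDl.
- by move=> c y z; rewrite mulmxDl scalerDr.
move=> r c y; rewrite /phi alphaE mulr_suml mulmx_suml big_ord_recl big1.
  rewrite addr0 expr0 -scalerAl mul1r -scalemxAl scalerA; congr (_ *: _).
  by rewrite mulrC.
move=> k _; rewrite -scalerAl -scalemxAl lift0 (exprS u) -mulrA -mul_lmx -mulmxA -/U UC.
by rewrite mulmx0 scaler0.
Qed.

(** A relative trace of the identity is a dual basis of the [K[t]/t^p]-module
    [S]: the coordinate [rho l] of [x] along the basis vector [l] has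
    coefficients [Theta (u^(p-1-i) x)]. *)
Lemma rank_flat : (n <= p * \rank (U ^+ p'))%N -> left_flat alpha.
Proof.
move=> le; have [Th ThE] := higman (ltn0Sn p') U_nil le.
pose c l i (x : S) : K := ((x : 'rV_n) *m U ^+ (p' - i) *m Th) 0 l.
pose rho l (x : S) : R := \sum_(i < p) c l i x *: t ^+ i.
have rhoL l a x y : rho l (a *: x + y) = a *: rho l x + rho l y.
  rewrite /rho scaler_sumr -big_split; apply: eq_bigr => i _ /=.
  rewrite scalerA -scalerDl; congr (_ *: _).
  by rewrite /c !mulmxDl -!scalemxAl !mxE.
have rho0 l : rho l 0 = 0.
  by rewrite -[0 in LHS]addr0 -[X in X + 0](scale0r 0) rhoL scale0r add0r;
     rewrite /rho big1 // => i _; rewrite /c !mul0mx mxE scale0r.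
have rhoD l x y : rho l (x + y) = rho l x + rho l y.
  by rewrite -[x in LHS]scale1r rhoL scale1r.
have rhoZ l a x : rho l (a *: x) = a *: rho l x.
  by rewrite -[a *: x]addr0 rhoL rho0 addr0.
have rhoU l x : rho l (u * x) = t * rho l x.
  rewrite /rho mulr_sumr big_ord_recl [RHS]big_ord_recr /=.
  rewrite -[in RHS]scalerAr -(exprS t) qXp0 // scaler0 addr0.
  rewrite {1}/c subn0 -mul_lmx -/U -!mulmxA [U *m (_ *m _)]mulmxA.
  rewrite [U *m _](esym (exprS _ _)) U_nil mul0mx mulmx0 mxE scale0r add0r.
  apply: eq_bigr => i _; rewrite -scalerAr -(exprS t) /bump leq0n add1n.
  congr (_ *: _); rewrite /c -!mulmxA [U *m (_ *m _)]mulmxA.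
  by rewrite [U *m _](esym (exprS _ _)) subnSK.
have rhoR l r x : rho l (alpha r * x) = r * rho l x.
  have rhoX i y : rho l (u ^+ i * y) = t ^+ i * rho l y.
    elim: i => [|i IH]; first by rewrite !expr0 !mul1r.
    by rewrite (exprS u) (exprS t) -!mulrA rhoU IH.
  rewrite alphaE {2}[r]truncpoly_sum // !mulr_suml.
  rewrite (big_morph (rho l) (rhoD l) (rho0 l)); apply: eq_bigr => i _.
  by rewrite -!scalerAl rhoZ rhoX.
have dual x : x = \sum_l alpha (rho l x) * grpalg_basis l.
  rewrite -[LHS]mulmx1 -ThE mulmx_sumr.
  transitivity (\sum_(i < p) u ^+ i * (\sum_l c l i x *: grpalg_basis l)).
    apply: eq_bigr => i _; rewrite -mul_lmx lmxX -/U !mulmxA; congr (_ *m _).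
    rewrite [LHS]grpalg_sum; apply: eq_bigr => l _.
    by [].
  transitivity (\sum_(i < p) \sum_l c l i x *: u ^+ i * grpalg_basis l).
    apply: eq_bigr => i _; rewrite mulr_sumr; apply: eq_bigr => l _.
    by rewrite -scalerAr scalerAl.
  rewrite exchange_big; apply: eq_bigr => l _; rewrite -mulr_suml; congr (_ * _).
  rewrite /rho linear_sum; apply: eq_bigr => i _; apply/esym.
  apply: etrans (linearZ_LR alpha _ _) _; congr (_ *: _); exact: rmorphXn.
move=> N' N f finj s s0 T phi phiDl phiDr phiB.
have phi0l y : phi 0 y = 0.
  by apply: (@addrI _ (phi 0 y)); rewrite -phiDl !addr0.
have phi0r m : phi m 0 = 0.
  by apply: (@addrI _ (phi m 0)); rewrite -phiDr !addr0.
have coord0 l : \sum_(v <- s) rho l v.2 *: v.1 = 0.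
  have e : \sum_(v <- s) rho l v.2 *: f v.1 = 0.
    have := s0 N (fun m x => rho l x *: m); rewrite big_map; apply.
    - by move=> m m' x; rewrite scalerDr.
    - by move=> m x x'; rewrite rhoD scalerDl.
    - by move=> r m x; rewrite rhoR scalerA mulrC.
  apply: finj; rewrite linear0 -e linear_sum.
  by apply: eq_bigr => v _; rewrite linearZ.
transitivity (\sum_(v <- s) \sum_l phi (rho l v.2 *: v.1) (grpalg_basis l)).
  apply: eq_bigr => v _; rewrite {1}[v.2]dual.
  rewrite (big_morph (phi v.1) (phiDr v.1) (phi0r v.1)).
  by apply: eq_bigr => l _; rewrite -phiB.
rewrite exchange_big big1 // => l _ /=.
by rewrite -(big_morph _ (fun a b => phiDl a b _) (phi0l _)) coord0 phi0l.
Qed.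

End Flat.

(** * Homomorphisms out of [K[t]/t^p] *)

Section TruncEval.
Variables (K : fieldType) (p : nat) (S : algType K).
Local Notation R := (truncpoly K p).

Definition trunc_eval (u : S) of (0 < p)%N & u ^+ p = 0 := fun r : R =>
  horner_alg u (r : {poly K}).

Variables (u : S) (p_gt0 : (0 < p)%N) (u_nil : u ^+ p = 0).
Local Notation ev := (trunc_eval p_gt0 u_nil).

Fact trunc_eval_linear : linear ev.
Proof. move=> c r s; rewrite /trunc_eval -mulr_algl -(horner_algC u) -rmorphM mul_polyC.
exact: rmorphD. Qed.

Fact trunc_eval_monoid : monoid_morphism ev.
Proof.
split; first exact: rmorph1.
have ev_mod (f : {poly K}) :
    horner_alg u (Pdiv.CommonRing.rmodp f (mk_monic 'X^p)) = horner_alg u f.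
  rewrite mk_monic_Xn prednK //.
  rewrite [in RHS](Pdiv.RingMonic.rdivp_eq (monicXn K p) f).
  rewrite rmorphD rmorphM /= rmorphXn /= [horner_alg u 'X]horner_algX u_nil.
  by rewrite mulr0 add0r.
by move=> r s; rewrite /trunc_eval -rmorphM; exact: ev_mod.
Qed.

HB.instance Definition _ := GRing.isLinear.Build K R S _ ev trunc_eval_linear.
HB.instance Definition _ := GRing.isMonoidMorphism.Build R S ev trunc_eval_monoid.

End TruncEval.

Lemma trunc_eval_qX (K : fieldType) p (S : algType K) (u : S) (p0 : (0 < p)%N)
    (up : u ^+ p = 0) : (1 < p)%N -> trunc_eval p0 up 'qX = u.
Proof.
move=> p1; rewrite /trunc_eval qpolyXE ?size_polyXn ?monicXn //.
exact: horner_algX.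
Qed.

(** * Abelian unipotent group schemes *)

Section GroupAlgebraFacts.
Variables (K : fieldType) (H : finGroupScheme K).

Lemma grpalg_counitM (f g : grpalg H) :
  grpalg_counit (f * g) = grpalg_counit f * grpalg_counit g.
Proof.
rewrite /grpalg_counit.
transitivity (\sum_i \sum_j (gs_one H i * gs_one H j) * (f 0 i * g 0 j)).
  under eq_bigr do rewrite grpalg_mulE mulr_sumr.
  rewrite exchange_big; apply: eq_bigr => i _ /=.
  under eq_bigr do rewrite mulr_sumr.
  rewrite exchange_big; apply: eq_bigr => j _ /=.
  by rewrite -gs_comul1 mulr_suml; apply: eq_bigr => l _; rewrite mulrA.
rewrite mulr_suml; apply: eq_bigr => i _; rewrite mulr_sumr; apply: eq_bigr => j _.
by rewrite mulrACA.
Qed.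

Lemma grpalg_counit1 : grpalg_counit (1 : grpalg H) = 1.
Proof. by rewrite -[RHS](gs_counit1 H); apply: eq_bigr => i _; rewrite grpalg_oneE. Qed.

Lemma grpalg_counit_linear c (f g : grpalg H) :
  grpalg_counit (c *: f + g) = c * grpalg_counit f + grpalg_counit g.
Proof.
rewrite /grpalg_counit mulr_sumr -big_split; apply: eq_bigr => i _ /=.
by rewrite !mxE mulrDr mulrCA.
Qed.

Lemma grpalg_counit_nil (f : grpalg H) e : f ^+ e = 0 -> grpalg_counit f = 0.
Proof.
move=> f0; have : grpalg_counit f ^+ e = 0.
  have -> : grpalg_counit f ^+ e = grpalg_counit (f ^+ e).
    elim: (e) => [|d IH]; first by rewrite !expr0 grpalg_counit1.
    by rewrite !exprS grpalg_counitM IH.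
  by rewrite f0 /grpalg_counit big1 // => i _; rewrite mxE mulr0.
by move/eqP; rewrite expf_eq0 => /andP[_ /eqP].
Qed.

Lemma grpalg_comm (f g : grpalg H) : abelian_scheme H -> f * g = g * f.
Proof.
move=> ab; apply/rowP => l; rewrite !grpalg_mulE exchange_big.
by apply: eq_bigr => i _; apply: eq_bigr => j _ /=; rewrite ab [f 0 _ * _]mulrC.
Qed.

(** For an abelian group scheme this is equivalent to being unipotent, and it can
    be tested on a basis, which makes it stable under extension of scalars. *)
Definition nil_augmentation : Prop :=
  forall f : grpalg H, grpalg_counit f = 0 -> exists e, f ^+ e = 0.

(** If [f] were not nilpotent, the Fitting component [f^N A] would be a nonzero
    module on which [f] acts invertibly, yet kills the fixed vectors. *)
Lemma unipotent_nil : abelian_scheme H -> unipotent_scheme H -> nil_augmentation.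
Proof.
move=> ab uni f f0; pose U := lmx f.
have [N NE] : exists N, \rank (U ^+ N.+1) = \rank (U ^+ N).
  have ex : exists r, [exists N : 'I_(gs_order H).+1, \rank (U ^+ N) == r].
    by exists (\rank (U ^+ 0)); apply/existsP; exists ord0.
  suff [N lt] : exists N, (\rank (U ^+ N) <= \rank (U ^+ N.+1))%N.
    exists N; apply/eqP; rewrite eqn_leq lt andbT exprS -mulmx_ring.
    exact: mxrankM_maxr.
  suff /existsP [N] : [exists N : 'I_(gs_order H).+1,
      (\rank (U ^+ N) <= \rank (U ^+ N.+1))%N] by exists N.
  apply/contraT; rewrite negb_exists => /forallP bad.
  have low d : (d <= (gs_order H).+1)%N -> (\rank (U ^+ d) + d <= gs_order H)%N.
    elim: d => [|d IH] dn; first by rewrite addn0 rank_leq_row.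
    by have := bad (Ordinal dn); rewrite -ltnNge /=; have := IH (ltnW dn); lia.
  by have := low _ (leqnn _); lia.
have [e|rk0] := posnP (\rank (U ^+ N)).
  exists N; apply: lmx_inj; rewrite lmxX linear0; apply/eqP.
  by rewrite -mxrank_eq0 -/U e.
pose W := U ^+ N.
have [B [B' [BW BB BK]]] : exists (B : 'M_(\rank W, _)) (B' : 'M_(_, \rank W)),
    [/\ (B :=: W)%MS, B *m B' = 1%:M
      & forall m (A : 'M_(m, _)), (A <= B)%MS -> A *m B' *m B = A].
  exists (row_base W), (pinvmx (row_base W)); split; first exact: eq_row_base.
    by apply: mulmxVp; exact: row_base_free.
  by move=> m A; exact: mulmxKpV.
have stab y : (B *m lmx y <= B)%MS.
  rewrite (eqmxMr _ BW) BW; apply/submxP; exists (lmx y).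
  by rewrite /W -lmxX -!lmxM grpalg_comm.
pose act y : 'M_(\rank W) := (B *m lmx y *m B')^T.
have act_lin : linear act.
  move=> c y z; rewrite /act linearP mulmxDr mulmxDl linearD /=.
  by rewrite -scalemxAr -scalemxAl linearZ.
have act1 : act 1 = 1%:M by rewrite /act lmx1 mulmx1 BB trmx1.
have actM y z : act (y * z) = act y *m act z.
  by rewrite /act -trmx_mul !mulmxA (BK _ (B *m lmx z)) // lmxM !mulmxA.
have [v v0 vfix] := uni (FdMod act_lin act1 actM) rk0.
pose w : 'rV_(gs_order H) := v^T *m B.
have wU : w *m U = 0.
  rewrite /w -mulmxA -(BK _ _ (stab f)) mulmxA -[B *m _ *m _]trmxK -trmx_mul.
  by have /= -> := vfix f; rewrite f0 scale0r trmx0 mul0mx.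
have /submxP [z wz] : (w <= W)%MS by rewrite -BW submxMl.
have zU : z *m U ^+ N.+1 = 0 by rewrite exprSr -mulmx_ring mulmxA -wz.
have : (kermx (U ^+ N.+1) <= kermx W)%MS.
  have sub : (kermx W <= kermx (U ^+ N.+1))%MS.
    by apply/sub_kermxP; rewrite exprSr -mulmx_ring mulmxA mulmx_ker mul0mx.
  by rewrite -(mxrank_leqif_sup sub) !mxrank_ker NE.
have zk : (z <= kermx (U ^+ N.+1))%MS by apply/sub_kermxP.
move/(submx_trans zk)/sub_kermxP; rewrite -wz /w => vB.
case/eqP: v0; rewrite -[v]trmxK -[v^T]mulmx1 -BB mulmxA vB mul0mx.
exact: trmx0.
Qed.

(** The last clause carries the induction: a vector already killed by an operator
    that commutes with the list may be replaced by one killed by the list too. *)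
Lemma common_kernel n (l : seq 'M[K]_n) (v : 'cV[K]_n) :
  {in l &, forall E F, E *m F = F *m E} -> {in l, forall E, exists e, E ^+ e = 0} ->
  v != 0 -> exists w : 'cV[K]_n, [/\ w != 0, {in l, forall E, E *m w = 0}
    & forall F, {in l, forall E, F *m E = E *m F} -> F *m v = 0 -> F *m w = 0].
Proof.
elim: l v => [|E l IH] v cm nil v0; first by exists v; split.
have [e Ee] := nil E (mem_head _ _).
have ex : exists k, E ^+ k *m v == 0 by exists e; rewrite Ee mul0mx.
case: (ex_minnP ex) => -[|k] /eqP Ek min; first by case/eqP: v0; rewrite -Ek expr0 mul1mx.
have Ekv : E ^+ k *m v != 0 by apply/negP => /min; rewrite ltnn.
have commX F : F *m E = E *m F -> F *m v = 0 -> F *m (E ^+ k *m v) = 0.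
  by move=> c Fv; rewrite mulmxA (intertwineX k c) -mulmxA Fv mulmx0.
have [||w [w0 wl wF]] := IH _ _ _ Ekv.
- by move=> F F' Fl Fl'; apply: cm; rewrite inE ?Fl ?Fl' orbT.
- by move=> F Fl; apply: nil; rewrite inE Fl orbT.
exists w; split => //.
  move=> F; rewrite inE => /orP[/eqP->|/wl //]; apply: wF.
    by move=> F' F'l; apply: cm; rewrite ?mem_head // inE F'l orbT.
  by rewrite mulmxA [E *m E ^+ k](esym (exprS _ _)).
move=> F cF Fv; apply: wF => [F' F'l|]; first by apply: cF; rewrite inE F'l orbT.
by apply: commX => //; apply: cF; rewrite mem_head.
Qed.

Lemma nil_unipotent : abelian_scheme H ->
  (forall i, exists e,
     (grpalg_basis i - (grpalg_counit (grpalg_basis i))%:A : grpalg H) ^+ e = 0) ->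
  unipotent_scheme H.
Proof.
move=> ab nil M dM.
pose b (i : 'I_(gs_order H)) : grpalg H :=
  grpalg_basis i - (grpalg_counit (grpalg_basis i))%:A.
pose l := [seq fd_act M (b i) | i <- enum 'I_(gs_order H)].
pose v : 'cV[K]_(fd_dim M) := const_mx 1.
have [|||w [w0 wl _]] := @common_kernel _ l v.
- move=> _ _ /mapP[i _ ->] /mapP[j _ ->]; rewrite -!fd_mul; congr (fd_act M _).
  exact: grpalg_comm.
- by move=> _ /mapP[i _ ->]; have [e be] := nil i; exists e; rewrite -fd_actX be linear0.
- apply/eqP => /matrixP /(_ (Ordinal dM) 0); rewrite !mxE => /eqP.
  by rewrite oner_eq0.
exists w => // x.
have actb i : fd_act M (grpalg_basis i) *m w = grpalg_counit (grpalg_basis i) *: w.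
  have /wl : fd_act M (b i) \in l by apply: map_f; rewrite mem_enum.
  rewrite linearB linearZ /= fd_one mulmxBl -scalemxAl mul1mx => /eqP.
  by rewrite subr_eq0 => /eqP.
rewrite {1}[x]grpalg_sum linear_sum mulmx_suml.
transitivity (\sum_i (x 0 i * grpalg_counit (grpalg_basis i)) *: w).
  by apply: eq_bigr => i _; rewrite linearZ /= -scalemxAl actb scalerA.
rewrite -scaler_suml; congr (_ *: _); rewrite [in RHS]/grpalg_counit.
apply: eq_bigr => i _; rewrite mulrC; congr (_ * _).
rewrite /grpalg_counit (bigD1 i) //= big1 ?addr0 => [|j ne].
  by rewrite mxE !eqxx mulr1.
by rewrite mxE (negPf ne) andbF mulr0.
Qed.

End GroupAlgebraFacts.

(** * Extension of scalars and subgroup schemes *)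

Section BaseChangeElements.
Variables (K L : fieldType) (j : {rmorphism K -> L}) (H : finGroupScheme K).
Local Notation HL := (base_change j H).

Definition bc (x : grpalg H) : grpalg HL := map_mx j x.

Lemma bcD x y : bc (x + y) = bc x + bc y.
Proof. exact: map_mxD. Qed.

Lemma bcZ c x : bc (c *: x) = j c *: bc x.
Proof. exact: map_mxZ. Qed.

Lemma bcM x y : bc (x * y) = bc x * bc y.
Proof.
apply/rowP => l; rewrite [RHS]grpalg_mulE mxE grpalg_mulE rmorph_sum.
apply: eq_bigr => a _; rewrite rmorph_sum; apply: eq_bigr => b _.
by rewrite !rmorphM !mxE.
Qed.

Lemma bc1 : bc 1 = 1.
Proof. by apply/rowP => l; rewrite mxE !grpalg_oneE. Qed.

Lemma bcX x e : bc (x ^+ e) = bc x ^+ e.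
Proof. by elim: e => [|e IH]; rewrite ?expr0 ?bc1 // !exprS bcM IH. Qed.

Lemma bc0 : bc 0 = 0.
Proof. exact: map_mx0. Qed.

Lemma bc_basis i : bc (grpalg_basis i) = grpalg_basis (i : 'I_(gs_order HL)).
Proof. exact: map_delta_mx. Qed.

Lemma bc_counit x : grpalg_counit (bc x) = j (grpalg_counit x).
Proof.
by rewrite /grpalg_counit rmorph_sum; apply: eq_bigr => i _; rewrite rmorphM mxE.
Qed.

Lemma bc_abelian : abelian_scheme H -> abelian_scheme HL.
Proof. by move=> ab l a b; rewrite /= ab. Qed.

Lemma bc_unipotent : abelian_scheme H -> nil_augmentation H -> unipotent_scheme HL.
Proof.
move=> ab nil; apply: nil_unipotent; first exact: bc_abelian.
move=> i; pose e : grpalg H := @grpalg_basis K H i.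
pose b : grpalg H := (- grpalg_counit e) *: 1 + e.
have [|m bm] := nil b.
  by rewrite grpalg_counit_linear grpalg_counit1 mulr1 addNr.
exists m; rewrite -bc0 -bm bcX; congr (_ ^+ _).
by rewrite /b bcD bcZ bc1 bc_basis rmorphN scaleNr -bc_counit bc_basis addrC.
Qed.

End BaseChangeElements.

Section SubgroupInclusion.
Variables (K : fieldType) (G : finGroupScheme K) (C : subgroupScheme G).

Fact sub_incl_linear : linear (@sub_incl K G C).
Proof. by move=> c x y; rewrite /sub_incl mulmxDl -scalemxAl. Qed.

Lemma sub_inclE (f : grpalg C) i : sub_incl f 0 i = \sum_s f 0 s * sub_res C i s.
Proof. by rewrite mxE; apply: eq_bigr => s _; rewrite mxE. Qed.

Fact sub_incl_monoid : monoid_morphism (@sub_incl K G C).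
Proof.
split=> [|f g].
  apply/rowP => i; rewrite sub_inclE grpalg_oneE -(sub_res_counit C).
  by apply: eq_bigr => s _; rewrite grpalg_oneE mulrC.
apply/rowP => i; rewrite sub_inclE grpalg_mulE.
transitivity (\sum_a \sum_b (\sum_s sub_res C i s * gs_comul C s a b)
    * (f 0 a * g 0 b)).
  under eq_bigr do rewrite grpalg_mulE mulr_suml.
  rewrite exchange_big; apply: eq_bigr => a _ /=.
  under eq_bigr do rewrite mulr_suml.
  rewrite exchange_big; apply: eq_bigr => b _ /=.
  by rewrite mulr_suml; apply: eq_bigr => s _; rewrite mulrAC [gs_comul _ _ _ _ * _]mulrC.
transitivity (\sum_c \sum_d \sum_a \sum_b gs_comul G i c d
    * (f 0 a * sub_res C c a * (g 0 b * sub_res C d b))).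
  under eq_bigr do under eq_bigr do rewrite sub_res_comul mulr_suml.
  under eq_bigr do rewrite exchange_big /=.
  rewrite exchange_big; apply: eq_bigr => c _ /=.
  under eq_bigr do under eq_bigr do rewrite mulr_suml.
  under eq_bigr do rewrite exchange_big /=.
  rewrite exchange_big; apply: eq_bigr => d _ /=.
  apply: eq_bigr => a _; apply: eq_bigr => b _.
  by rewrite -mulrA; congr (_ * _); rewrite mulrACA [_ * f 0 a]mulrC [_ * g 0 b]mulrC.
apply: eq_bigr => c _; apply: eq_bigr => d _.
rewrite !sub_inclE mulr_suml mulr_sumr; apply: eq_bigr => a _.
by rewrite !mulr_sumr.
Qed.

HB.instance Definition _ :=
  GRing.isLinear.Build K (grpalg C) (grpalg G) _ (@sub_incl K G C) sub_incl_linear.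
HB.instance Definition _ :=
  GRing.isMonoidMorphism.Build (grpalg C) (grpalg G) (@sub_incl K G C) sub_incl_monoid.

Lemma sub_incl_comul (f : grpalg C) i j :
  grpalg_comul (sub_incl f) i j =
  \sum_a \sum_b sub_res C i a * sub_res C j b * grpalg_comul f a b.
Proof.
rewrite /grpalg_comul.
transitivity (\sum_s (\sum_l gs_mul G i j l * sub_res C l s) * f 0 s).
  under eq_bigr do rewrite sub_inclE mulr_sumr.
  rewrite exchange_big; apply: eq_bigr => s _ /=; rewrite mulr_suml.
  by apply: eq_bigr => l _; rewrite mulrAC mulrA.
under eq_bigr do rewrite sub_resM mulr_suml.
rewrite exchange_big; apply: eq_bigr => a _ /=.
under eq_bigr do rewrite mulr_suml.
rewrite exchange_big; apply: eq_bigr => b _ /=.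
by rewrite mulr_sumr; apply: eq_bigr => s _; rewrite mulrA.
Qed.

End SubgroupInclusion.

Section SubgroupBaseChange.
Variables (k K L : fieldType) (iota : {rmorphism k -> K}) (j : {rmorphism K -> L}).
Variables (G : finGroupScheme k) (C : subgroupScheme (base_change iota G)).
Local Notation GK := (base_change iota G).
Local Notation GL := (base_change (j \o iota) G).
Local Notation CL := (base_change j C).

Let res : 'M[L]_(gs_order GL, gs_order CL) := map_mx j (sub_res C).

Fact bcsub_resM i i' s :
  \sum_l gs_mul GL i i' l * res l s
  = \sum_a \sum_b res i a * res i' b * gs_mul CL a b s.
Proof.
transitivity (j (\sum_l gs_mul GK i i' l * sub_res C l s)).
  by rewrite rmorph_sum; apply: eq_bigr => l _; rewrite rmorphM mxE.
rewrite sub_resM rmorph_sum; apply: eq_bigr => a _; rewrite rmorph_sum.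
by apply: eq_bigr => b _; rewrite !rmorphM !mxE.
Qed.

Fact bcsub_res1 s : \sum_i gs_one GL i * res i s = gs_one CL s.
Proof.
rewrite /= -(@sub_res1 _ _ C s) rmorph_sum.
by apply: eq_bigr => l _; rewrite rmorphM mxE.
Qed.

Fact bcsub_res_comul i a b :
  \sum_l res i l * gs_comul CL l a b
  = \sum_c \sum_d gs_comul GL i c d * (res c a * res d b).
Proof.
transitivity (j (\sum_l sub_res C i l * gs_comul C l a b)).
  by rewrite rmorph_sum; apply: eq_bigr => l _; rewrite rmorphM mxE.
rewrite sub_res_comul rmorph_sum; apply: eq_bigr => c _; rewrite rmorph_sum.
by apply: eq_bigr => d _; rewrite !rmorphM !mxE.
Qed.

Fact bcsub_res_counit i : \sum_s res i s * gs_counit CL s = gs_counit GL i.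
Proof.
transitivity (j (\sum_s sub_res C i s * gs_counit C s)).
  by rewrite rmorph_sum; apply: eq_bigr => l _; rewrite rmorphM mxE.
by rewrite sub_res_counit.
Qed.

Fact bcsub_res_surj : row_full res.
Proof. by rewrite /row_full mxrank_map; exact: sub_res_surj. Qed.

Definition bcsub : subgroupScheme GL :=
  SubgroupScheme bcsub_resM bcsub_res1 bcsub_res_comul bcsub_res_counit
    bcsub_res_surj.

Lemma bcsub_incl (x : grpalg C) :
  sub_incl (C := bcsub) (bc j x) = map_mx j (sub_incl x).
Proof. by rewrite /sub_incl map_mxM map_trmx. Qed.

Lemma lmx_bc (x : grpalg GK) : lmx (map_mx j x : grpalg GL) = map_mx j (lmx x).
Proof.
apply/matrixP => a b; rewrite !mxE rmorph_sum; apply: eq_bigr => i _.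
by rewrite rmorphM !mxE.
Qed.

Lemma bcmod_act_bc (M : fdmod (grpalg G)) (x : grpalg GK) :
  bcmod_act M (map_mx j x : grpalg GL) = map_mx j (bcmod_act M x).
Proof.
rewrite /bcmod_act raddf_sum; apply: eq_bigr => i _.
by rewrite /= map_mxZ mxE -map_mx_comp.
Qed.

End SubgroupBaseChange.

(** * The coproduct of a nilpotent element *)

Lemma sum_pchar_comm (K : fieldType) p n I (s : seq I) (F : I -> 'M[K]_n) :
  p \in [pchar K] -> (forall i j, GRing.comm (F i) (F j)) ->
  (\sum_(i <- s) F i) ^+ p = \sum_(i <- s) F i ^+ p.
Proof.
move=> pK cm; elim: s => [|i s IH].
  by rewrite !big_nil expr0n -[p]prednK ?prime_gt0 ?(pcharf_prime pK).
rewrite !big_cons -IH -[p]expn1 (exprD_pchar_comm _ pK) //.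
by apply: commr_sum.
Qed.

Lemma scalemxX (K : fieldType) n c (X : 'M[K]_n) e :
  (c *: X) ^+ e = c ^+ e *: X ^+ e.
Proof.
elim: e => [|e IH]; first by rewrite !expr0 scale1r.
by rewrite !exprS IH -!mulmx_ring -scalemxAr -scalemxAl scalerA mulrC.
Qed.

Section TensAct.
Variables (K : fieldType) (H : finGroupScheme K) (M N : fdmod (grpalg H)).
Notation actM i := (fd_act M (grpalg_basis i)).
Notation actN j := (fd_act N (grpalg_basis j)).

Lemma fd_act_sum (P : fdmod (grpalg H)) x :
  fd_act P x = \sum_i x 0 i *: fd_act P (grpalg_basis i).
Proof.
by rewrite {1}[x]grpalg_sum linear_sum; apply: eq_bigr => i _; rewrite linearZ.
Qed.

Lemma tens_act_prod (x y : grpalg H) :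
  \sum_i \sum_j (x 0 i * y 0 j) *: (actM i *t actN j) = fd_act M x *t fd_act N y.
Proof.
rewrite (fd_act_sum M x) (fd_act_sum N y) tens_suml; apply: eq_bigr => i _.
rewrite tens_sumr; apply: eq_bigr => j _.
by rewrite tensZl tensZr scalerA.
Qed.

End TensAct.

Section RegularSquare.
Variables (K : fieldType) (p : nat) (H : finGroupScheme K).
Hypotheses (pK : p \in [pchar K]) (ab : abelian_scheme H).
Local Notation n := (gs_order H).

Let lmxMc (x y : grpalg H) : lmx (x * y) = lmx x *m lmx y.
Proof. by rewrite grpalg_comm // lmxM. Qed.

Let reg : fdmod (grpalg H) := FdMod (@lmx_linear K H) (@lmx1 K H) lmxMc.

Let B i j := lmx (grpalg_basis (i : 'I_n)) *t lmx (grpalg_basis (j : 'I_n)).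

Let BC i j i' j' : GRing.comm (B i j) (B i' j').
Proof.
rewrite /GRing.comm -!mulmx_ring !tensmx_mul -!lmxMc.
by rewrite (grpalg_comm (grpalg_basis i)) // (grpalg_comm (grpalg_basis j)).
Qed.

(** [prim_defect u] is [Delta u - u (x) 1 - 1 (x) u]. *)
Definition prim_defect (u : grpalg H) (i j : 'I_n) : K :=
  grpalg_comul u i j - u 0 i * gs_counit H j - gs_counit H i * u 0 j.

(** The matrix of the Frobenius map [x |-> x^p] of the group algebra. *)
Definition frob_mx : 'M[K]_n := \matrix_(i, l) ((grpalg_basis i : grpalg H) ^+ p) 0 l.

Lemma exprp_frob_mx (x : grpalg H) l :
  (x ^+ p) 0 l = \sum_i x 0 i ^+ p * frob_mx i l.
Proof.
have e : lmx (x ^+ p) = lmx (\sum_i x 0 i ^+ p *: (grpalg_basis i) ^+ p).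
  rewrite lmxX {1}[x]grpalg_sum !linear_sum /=.
  rewrite (sum_pchar_comm _ pK) => [|i j]; last first.
    by rewrite /GRing.comm -!mulmx_ring -!lmxMc grpalg_comm.
  by apply: eq_bigr => i _; rewrite !linearZ /= lmxX scalemxX.
rewrite (lmx_inj e) summxE; apply: eq_bigr => i _.
by rewrite !mxE.
Qed.

(** [w = Delta u - u (x) 1 - 1 (x) u] satisfies [w^p = 0] in the commutative ring
    [A (x) A], because [Delta] is a ring homomorphism; expanding [w^p] in the
    basis gives a relation between the [p]-th powers of the coefficients of
    [w]. *)
Lemma prim_defect_pow (u : grpalg H) l m : u ^+ p = 0 ->
  \sum_i \sum_j prim_defect u i j ^+ p * (frob_mx i l * frob_mx j m) = 0.
Proof.
move=> up; have p_gt0 : (0 < p)%N := prime_gt0 (pcharf_prime pK).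
pose X := lmx u *t (1%:M : 'M[K]_n); pose Y := (1%:M : 'M[K]_n) *t lmx u.
pose w := \sum_(ij : 'I_n * 'I_n) prim_defect u ij.1 ij.2 *: B ij.1 ij.2.
have XE : X = \sum_i \sum_j (u 0 i * gs_counit H j) *: B i j.
  rewrite /X -lmx1 -(tens_act_prod reg reg u 1).
  by apply: eq_bigr => i _; apply: eq_bigr => j _; rewrite grpalg_oneE.
have YE : Y = \sum_i \sum_j (gs_counit H i * u 0 j) *: B i j.
  rewrite /Y -lmx1 -(tens_act_prod reg reg 1 u).
  by apply: eq_bigr => i _; apply: eq_bigr => j _; rewrite grpalg_oneE.
have TE : tens_act reg reg u = w + Y + X.
  rewrite XE YE /w pair_bigA /= !pair_bigA -!big_split /= /tens_act pair_bigA /=.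
  by apply: eq_bigr => -[i j] _ /=; rewrite -!scalerDl /prim_defect addrNK addrNK.
have cB (c : 'I_n -> 'I_n -> K) Z :
    (forall i j, GRing.comm Z (B i j)) -> GRing.comm Z (\sum_i \sum_j c i j *: B i j).
  move=> cZ; apply: commr_sum => i _; apply: commr_sum => j _.
  rewrite /GRing.comm -!mulmx_ring -scalemxAr -scalemxAl; congr (_ *: _).
  exact: cZ.
have cB' i j (c : 'I_n -> 'I_n -> K) : GRing.comm (B i j) (\sum_i \sum_j c i j *: B i j).
  by apply: cB => i' j'.
have wE : w = \sum_i \sum_j prim_defect u i j *: B i j by rewrite /w pair_bigA.
have cXY : GRing.comm X Y.
  by rewrite XE; apply/commr_sym; rewrite YE; apply: cB => i j; apply/commr_sym.
have cwX : GRing.comm w X.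
  by rewrite XE; apply: cB => i j; apply/commr_sym; rewrite wE.
have cwY : GRing.comm w Y.
  by rewrite YE; apply: cB => i j; apply/commr_sym; rewrite wE.
have wp : w ^+ p = 0.
  have Xp : X ^+ p = 0 by rewrite tensX -lmxX up linear0 tens0mx.
  have Yp : Y ^+ p = 0 by rewrite tensX -lmxX up linear0 tensmx0.
  have : tens_act reg reg u ^+ p = 0.
    rewrite -[LHS](fd_actX (fd_tens reg reg)) up; exact: (linear0 (fd_act (fd_tens reg reg))).
  have e := @exprD_pchar_comm K p _ _ _ 1 pK; rewrite expn1 in e.
  rewrite TE e; last by apply/commr_sym/commrD => //; apply/commr_sym.
  by rewrite e // Xp Yp !addr0.
have wpE : w ^+ p = \sum_l \sum_m
    (\sum_i \sum_j prim_defect u i j ^+ p * (frob_mx i l * frob_mx j m)) *: B l m.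
  rewrite /w (sum_pchar_comm _ pK) => [|a b]; last first.
    rewrite /GRing.comm -!mulmx_ring -!scalemxAr -!scalemxAl !scalerA mulrC.
    by congr (_ *: _); exact: BC.
  transitivity (\sum_(ij : 'I_n * 'I_n) \sum_l \sum_m
      (prim_defect u ij.1 ij.2 ^+ p * (frob_mx ij.1 l * frob_mx ij.2 m)) *: B l m).
    apply: eq_bigr => -[i j] _ /=; rewrite scalemxX /B tensX -!lmxX.
    have pw (a : 'I_n) : lmx (grpalg_basis a ^+ p)
        = \sum_l frob_mx a l *: lmx (grpalg_basis l).
      rewrite [grpalg_basis a ^+ p]grpalg_sum linear_sum.
      by apply: eq_bigr => c _; rewrite linearZ mxE.
    rewrite !pw tens_suml scaler_sumr; apply: eq_bigr => c _.
    rewrite tens_sumr scaler_sumr; apply: eq_bigr => d _.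
    by rewrite tensZl tensZr !scalerA mulrA.
  rewrite exchange_big; apply: eq_bigr => c _ /=.
  rewrite exchange_big; apply: eq_bigr => d _ /=.
  by rewrite -scaler_suml pair_bigA.
have := congr1 (fun Z => ((1 : grpalg H) : 'rV_n) *t ((1 : grpalg H) : 'rV_n) *m Z) wpE.
rewrite wp mulmx0 mulmx_sumr.
move/(congr1 (fun Z : 'M_(1 * 1, n * n) => Z (mxtens_index (0, 0)) (mxtens_index (l, m)))).
rewrite mxE summxE (bigD1 l) //= [X in _ + X]big1 ?addr0; last first.
  move=> c ne; rewrite mulmx_sumr summxE big1 // => d _.
  rewrite -scalemxAr mxE /B tensmx_mul !mul_lmx !mulr1 tensmxE [grpalg_basis c 0 l]mxE.
  by rewrite [l == c]eq_sym (negPf ne) andbF mul0r mulr0.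
rewrite mulmx_sumr summxE (bigD1 m) //= [X in _ + X]big1 ?addr0; last first.
  move=> d ne.
  rewrite -scalemxAr mxE /B tensmx_mul !mul_lmx !mulr1 tensmxE [grpalg_basis d 0 m]mxE.
  by rewrite [m == d]eq_sym (negPf ne) andbF !mulr0.
rewrite -scalemxAr mxE /B tensmx_mul !mul_lmx !mulr1 tensmxE.
by rewrite !mxE !eqxx !mulr1.
Qed.

End RegularSquare.

Section FrobeniusTwist.
Variables (K : fieldType) (p : nat) (H : finGroupScheme K).
Hypotheses (pK : p \in [pchar K]) (ab : abelian_scheme H).
Hypothesis uni : unipotent_scheme H.
Local Notation n := (gs_order H).
Local Notation phi := (pFrobenius_aut pK : {rmorphism K -> K}).
Local Notation HL := (base_change phi H).

Let p_gt0 : (0 < p)%N := prime_gt0 (pcharf_prime pK).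

Let phiE x : phi x = x ^+ p.
Proof. exact: pFrobenius_autE. Qed.

(** [(1 (x) eps) Delta = id] and [eps u = 0]: the element [w] lies in [I (x) I],
    with [I] the augmentation ideal. *)
Lemma prim_defect_counit (u : grpalg H) : u ^+ p = 0 ->
  (forall i, \sum_j prim_defect u i j * gs_one H j = 0)
  /\ (forall j, \sum_i prim_defect u i j * gs_one H i = 0).
Proof.
move=> up; have u0 : \sum_l u 0 l * gs_one H l = 0.
  rewrite -[RHS](grpalg_counit_nil up); apply: eq_bigr => l _.
  by rewrite mulrC.
have e1 : \sum_l gs_counit H l * gs_one H l = 1.
  by rewrite -[RHS](gs_counit1 H); apply: eq_bigr => l _; rewrite mulrC.
have half i : \sum_j grpalg_comul u i j * gs_one H j = u 0 i.
  transitivity (\sum_l (i == l)%:R * u 0 l).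
    rewrite /grpalg_comul; under eq_bigr do rewrite mulr_suml.
    rewrite exchange_big; apply: eq_bigr => l _ /=; rewrite -(gs_mul1 i l) mulr_suml.
    by apply: eq_bigr => j _; rewrite gs_mulC mulrC mulrA.
  rewrite (bigD1 i) //= big1 ?addr0 ?eqxx ?mul1r // => l ne.
  by rewrite eq_sym (negPf ne) mul0r.
have sym i j : grpalg_comul u i j = grpalg_comul u j i.
  by apply: eq_bigr => l _; rewrite gs_mulC.
split=> i; rewrite /prim_defect.
  under eq_bigr do rewrite !mulrBl -!mulrA.
  by rewrite !sumrB half -!mulr_sumr e1 u0 mulr1 mulr0 subrr subr0.
under eq_bigr do rewrite !mulrBl sym mulrAC [_ * u 0 i * _]mulrAC.
by rewrite !sumrB half -!mulr_suml e1 u0 mul1r mul0r subr0 subrr.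
Qed.

(** Over a perfect field the kernel of the Frobenius map of [A (x) A] is
    [J (x) A + A (x) J], with [J] the kernel for [A].  Here [w] is a matrix, [D]
    is the matrix of Frobenius, and [w^p = 0] reads [D^T w^(p) D = 0]; after
    extending scalars along the Frobenius map of [K] itself the coefficients
    of [w] are already [p]-th powers, so no root has to be adjoined. *)
Lemma comul_frobenius_twist (u : grpalg H) : u ^+ p = 0 ->
  exists xi b b' : 'I_n -> grpalg HL,
  [/\ forall l, xi l ^+ p = 0,
      forall l, exists e, b l ^+ e = 0,
      forall l, exists e, b' l ^+ e = 0
    & forall i j, grpalg_comul (bc phi u) i j =
        bc phi u 0 i * gs_counit HL j + gs_counit HL i * bc phi u 0 j
        + \sum_l (xi l 0 i * b l 0 j + b' l 0 i * xi l 0 j)].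
Proof.
move=> up; have nilL : nil_augmentation HL.
  apply: unipotent_nil; first exact: bc_abelian.
  by apply: bc_unipotent => //; exact: unipotent_nil.
pose W : 'M[K]_n := \matrix_(i, j) phi (prim_defect u i j).
pose D : 'M[K]_n := frob_mx p H.
have DWD : D^T *m W *m D = 0.
  apply/matrixP => l m; rewrite [RHS]mxE -[RHS](prim_defect_pow pK ab l m up) -mulmxA mxE.
  apply: eq_bigr => i _; rewrite !mxE mulr_sumr; apply: eq_bigr => j _.
  by rewrite !mxE phiE mulrCA.
pose Dv := pinvmx D; pose f := D *m Dv; pose e := 1%:M - f.
have eD : e *m D = 0 by rewrite /e mulmxBl mul1mx /f mulmxKpV // subrr.
have ef : e + f = 1%:M by rewrite /e subrK.
have WE : W = e^T *m W + f^T *m W *m e.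
  have fWf : f^T *m W *m f = 0.
    by rewrite /f trmx_mul -!mulmxA [W *m (D *m _)]mulmxA [D^T *m _]mulmxA
      [D^T *m _]mulmxA DWD mul0mx mulmx0.
  have -> : f^T *m W *m e = f^T *m W.
    by rewrite /e mulmxBr mulmx1 fWf subr0.
  by rewrite -mulmxDl -linearD /= ef trmx1 mul1mx.
pose xi l : grpalg HL := row l e.
have xip l : xi l ^+ p = 0.
  apply/rowP => m.
  rewrite (@exprp_frob_mx K p HL pK) ?mxE; last exact: bc_abelian.
  have em : phi ((e *m D) l m) = 0 by rewrite eD mxE rmorph0.
  rewrite -[RHS]em mxE rmorph_sum; apply: eq_bigr => i _; rewrite rmorphM /= [xi l 0 i]mxE.
  rewrite phiE; congr (_ * _).
  by rewrite !mxE -bc_basis -bcX mxE.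
have [Wr Wl] := prim_defect_counit up.
have Wone (j : 'I_n) : \sum_i W i j * phi (gs_one H i) = 0.
  have em := congr1 phi (Wl j); rewrite rmorph0 in em.
  rewrite -[RHS]em rmorph_sum; by apply: eq_bigr => i _; rewrite !mxE -rmorphM.
have eone l : \sum_m e l m * phi (gs_one H m) = 0.
  rewrite -[RHS](grpalg_counit_nil (xip l)); apply: eq_bigr => m _.
  by rewrite [xi l 0 m]mxE mulrC.
have fone l : \sum_m f l m * phi (gs_one H m) = phi (gs_one H l).
  transitivity (\sum_m (e l m + f l m) * phi (gs_one H m)).
    by rewrite (eq_bigr _ (fun m _ => mulrDl _ _ _)) big_split /= eone add0r.
  have efE m : e l m + f l m = (l == m)%:R.
    by have := congr1 (fun Z : 'M_n => Z l m) ef; rewrite !mxE.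
  rewrite (bigD1 l) //= big1 ?addr0 => [|m ne]; first by rewrite efE eqxx mul1r.
  by rewrite efE eq_sym (negPf ne) mul0r.
exists xi, (fun l => row l W), (fun l => row l (W^T *m f)); split=> //.
- move=> l; apply: nilL; have em := congr1 phi (Wr l); rewrite rmorph0 in em.
  rewrite -[RHS]em rmorph_sum; apply: eq_bigr => j _.
  by rewrite !mxE mulrC -rmorphM.
- move=> l; apply: nilL; rewrite -[RHS](Wone l).
  transitivity (\sum_j \sum_i W i l * (f i j * phi (gs_one H j))).
    apply: eq_bigr => j _; rewrite !mxE mulr_sumr; apply: eq_bigr => i _.
    by rewrite !mxE mulrC mulrA.
  rewrite exchange_big; apply: eq_bigr => i _ /=.
  by rewrite -mulr_sumr fone.
move=> i j.
have -> : grpalg_comul (bc phi u) i j = phi (grpalg_comul u i j).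
  rewrite /grpalg_comul rmorph_sum; apply: eq_bigr => l _.
  by rewrite rmorphM mxE.
have -> : grpalg_comul u i j
    = u 0 i * gs_counit H j + gs_counit H i * u 0 j + prim_defect u i j.
  by rewrite /prim_defect [RHS]addrC addrA addrAC !addrNK.
move wE: (prim_defect u i j) => w.
rewrite !rmorphD !rmorphM; congr (_ + _); first by rewrite /= !mxE.
transitivity (W i j); first by rewrite mxE wE.
rewrite {1}WE mxE big_split /=; congr (_ + _); rewrite mxE.
  by apply: eq_bigr => l _; rewrite !mxE.
apply: eq_bigr => l _; rewrite [RHS](_ : _ = (W^T *m f) l i * e l j); last by rewrite !mxE.
congr (_ * _); rewrite !mxE; apply: eq_bigr => m _.
by rewrite !mxE mulrC.
Qed.

End FrobeniusTwist.

(** * Tensor products of modules of constant Jordan type *)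

Section Points.
Variables (p : nat) (K : fieldType) (G : finGroupScheme K) (C : subgroupScheme G).

(** The elements of [KC] that are the image of [t] under a flat map
    [K[t]/t^p -> KG]. *)
Definition flat_nilpotent (u : grpalg C) : Prop :=
  u ^+ p = 0 /\ (gs_order G <= p * \rank (lmx (sub_incl u) ^+ p.-1))%N.

Definition sub_mod (M : fdmod (grpalg G)) : fdmod (grpalg C) :=
  fd_restr (@sub_incl K G C) M.

End Points.

Lemma trunc_morph_eq (K : fieldType) p (p_gt0 : (0 < p)%N) (S : algType K)
    (f g : {lrmorphism truncpoly K p -> S}) :
  f 'qX = g 'qX -> f =1 g.
Proof.
move=> e r; rewrite [r](truncpoly_sum p_gt0) !linear_sum; apply: eq_bigr => i _.
apply: etrans (linearZ_LR f _ _) _; apply: etrans (esym (linearZ_LR g _ _)).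
congr (_ *: _); apply: etrans (rmorphXn f _ _) _.
by apply: etrans (esym (rmorphXn g _ _)); congr (_ ^+ _).
Qed.

Section PiPoints.
Variables (p : nat) (k K : fieldType) (iota : {rmorphism k -> K}).
Variables (G : finGroupScheme k).
Hypothesis p_gt1 : (1 < p)%N.
Local Notation GK := (base_change iota G).

Lemma pi_point_element (alpha : pi_point p iota G) :
  exists (C : subgroupScheme GK) (u : grpalg C),
    [/\ abelian_scheme C, unipotent_scheme C, flat_nilpotent p u
      & pi_map alpha 'qX = sub_incl u].
Proof.
case: alpha => al flat [C [ab uni [beta fac]]] /=.
exists C, (beta 'qX); split=> //; split.
  rewrite -rmorphXn qXp0 ?(ltnW p_gt1) //; exact: rmorph0.
rewrite -fac; case: (p) p_gt1 al beta fac flat => // p' _ al beta fac flat.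
exact: flat_rank flat.
Qed.

Lemma element_pi_point (C : subgroupScheme GK) (u : grpalg C) :
  abelian_scheme C -> unipotent_scheme C -> flat_nilpotent p u ->
  exists alpha : pi_point p iota G, pi_map alpha 'qX = sub_incl u.
Proof.
move=> ab uni [up le]; have p_gt0 := ltnW p_gt1.
have vp : (sub_incl u : grpalg GK) ^+ p = 0 by rewrite -rmorphXn up rmorph0.
pose al := trunc_eval p_gt0 vp; pose be := trunc_eval p_gt0 up.
have alX : al 'qX = sub_incl u by exact: trunc_eval_qX.
have beX : be 'qX = u by exact: trunc_eval_qX.
have flat : left_flat al.
  case: (p) p_gt0 p_gt1 le vp @al alX {up be beX} => // p' p0 p1 le vp al alX.
  apply: rank_flat.
  exact: (eq_ind_r (fun x => gs_order GK <= p'.+1 * \rank (lmx x ^+ p'))%N le alX).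
have fac : exists D : subgroupScheme GK,
    [/\ abelian_scheme D, unipotent_scheme D
      & exists beta : {lrmorphism truncpoly K p -> grpalg D},
          forall r, al r = sub_incl (beta r)].
  exists C; split=> //; exists be => r.
  apply: (@trunc_morph_eq _ _ p_gt0 _ al (@sub_incl K GK C \o be)).
  exact: etrans alX (congr1 _ (esym beX)).
by exists (PiPoint flat fac).
Qed.

Lemma restr_rank (C : subgroupScheme GK) (u : grpalg C) M a :
  (forall (L : fieldType) (j : {rmorphism k -> L}) (alpha : pi_point p j G),
     has_jordan_type (fd_restr (pi_map alpha) (fd_base_change j M)) a) ->
  abelian_scheme C -> unipotent_scheme C -> flat_nilpotent p u ->
  forall j, \rank (fd_act (sub_mod C (fd_base_change iota M)) u ^+ j)
    = jordan_rank (p := p) a j.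
Proof.
move=> Ma ab uni fl j.
have [alpha e] := element_pi_point ab uni fl.
have /(jordan_typeP (ltnW p_gt1)) rk := Ma K iota alpha.
by rewrite -rk /= e.
Qed.

End PiPoints.

Section BaseChangePoints.
Variables (p : nat) (k K L : fieldType) (iota : {rmorphism k -> K}).
Variables (j : {rmorphism K -> L}) (G : finGroupScheme k).
Variable C : subgroupScheme (base_change iota G).
Local Notation CL := (bcsub j C).

Lemma sub_mod_bc (M : fdmod (grpalg G)) (x : grpalg C) :
  fd_act (sub_mod CL (fd_base_change (j \o iota) M)) (bc j x)
  = map_mx j (fd_act (sub_mod C (fd_base_change iota M)) x).
Proof. by rewrite /= bcsub_incl; exact: bcmod_act_bc. Qed.

Lemma flat_nilpotent_bc (u : grpalg C) :
  flat_nilpotent p u -> flat_nilpotent (C := CL) p (bc j u).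
Proof.
move=> [up le]; split; first by rewrite -bcX up bc0.
rewrite bcsub_incl lmx_bc.
by rewrite -map_mxX mxrank_map.
Qed.

End BaseChangePoints.

(** Moving [u] generically in the direction of a [p]-nilpotent element keeps it
    [p]-nilpotent, and flat because the rank condition is open. *)
Lemma flat_nilpotent_pencil (p : nat) (k K : fieldType) (iota : {rmorphism k -> K})
    (G : finGroupScheme k) (C : subgroupScheme (base_change iota G)) (u xi : grpalg C) :
  p \in [pchar K] -> abelian_scheme C -> flat_nilpotent p u -> xi ^+ p = 0 ->
  flat_nilpotent (C := bcsub (ratC K) C) p (bc (ratC K) u + tofrac 'X *: bc (ratC K) xi).
Proof.
move=> pK ab [up le] xip; split.
  have pL : p \in [pchar {fraction {poly K}}] by exact: rmorph_pchar (ratC K) _ pK.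
  have pA : p \in [pchar grpalg (bcsub (ratC K) C)].
    exact: rmorph_pchar (in_alg (grpalg (bcsub (ratC K) C))) _ pL.
  rewrite -(pFrobenius_autE pA) pFrobenius_autD_comm; last first.
    by apply: grpalg_comm; exact: bc_abelian.
  by rewrite !pFrobenius_autE exprZn -!bcX up xip bc0 scaler0 addr0.
rewrite linearD linearZ /= !bcsub_incl linearD linearZ /= !lmx_bc.
apply: leq_trans le _; rewrite leq_mul2l; apply/orP; right.
exact: rank_rat_pencil.
Qed.

Section TensorFamily.
Variables (p : nat) (k : fieldType) (G : finGroupScheme k) (M N : fdmod (grpalg G)).
Hypothesis pk : p \in [pchar k].

(** The operators [u (x) 1 + 1 (x) v] on [M (x) N] given by two points of the same
    subgroup, together with [p]-nilpotent directions in either factor. *)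
Definition tensor_family (K : fieldType) (X : 'M[K]_(fd_dim M * fd_dim N))
    (l : seq 'M[K]_(fd_dim M * fd_dim N)) : Prop :=
  exists (iota : {rmorphism k -> K}) (C : subgroupScheme (base_change iota G))
    (u v : grpalg C),
  let act1 x : 'M[K]_(fd_dim M * fd_dim N) :=
    fd_act (sub_mod C (fd_base_change iota M)) x *t 1%:M in
  let act2 x : 'M[K]_(fd_dim M * fd_dim N) :=
    1%:M *t fd_act (sub_mod C (fd_base_change iota N)) x in
  [/\ abelian_scheme C /\ unipotent_scheme C, flat_nilpotent p u, flat_nilpotent p v,
      X = act1 u + act2 v
    & forall Xi, Xi \in l -> exists2 xi : grpalg C, xi ^+ p = 0
        & Xi = act1 xi \/ Xi = act2 xi].

Arguments tensor_family : clear implicits.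

Lemma tensor_family_pencil (K : fieldType) (X Xi : 'M[K]_(fd_dim M * fd_dim N)) l :
  tensor_family K X (Xi :: l) ->
  tensor_family {fraction {poly K}} (rat_pencil X Xi) (map (map_mx (ratC K)) l).
Proof.
move=> [iota [C [u [v /= [[ab uni] fu fv XE lE]]]]].
have pK : p \in [pchar K] by exact: rmorph_pchar iota _ pk.
pose j := ratC K; pose CL := bcsub j C.
have uniL : unipotent_scheme CL by apply: bc_unipotent => //; exact: unipotent_nil.
pose a1 (x : grpalg CL) := fd_act (sub_mod CL (fd_base_change (j \o iota) M)) x *t
  (1%:M : 'M_(fd_dim N)).
pose a2 (x : grpalg CL) := (1%:M : 'M_(fd_dim M)) *t
  fd_act (sub_mod CL (fd_base_change (j \o iota) N)) x.
have a1E x : a1 (bc j x)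
    = map_mx j (fd_act (sub_mod C (fd_base_change iota M)) x *t 1%:M).
  by rewrite /a1 sub_mod_bc map_mxT map_mx1.
have a2E x : a2 (bc j x)
    = map_mx j (1%:M *t fd_act (sub_mod C (fd_base_change iota N)) x).
  by rewrite /a2 sub_mod_bc map_mxT map_mx1.
have a1L x c y : a1 (x + c *: y) = a1 x + c *: a1 y.
  rewrite /a1 linearD linearZ -tensZl.
  by apply/matrixP => i i'; rewrite !mxE mulrDl.
have a2L x c y : a2 (x + c *: y) = a2 x + c *: a2 y.
  rewrite /a2 linearD linearZ -tensZr.
  by apply/matrixP => i i'; rewrite !mxE mulrDr.
have fuL := flat_nilpotent_bc j fu; have fvL := flat_nilpotent_bc j fv.
have lL : forall Z, Z \in map (map_mx j) l -> exists2 xi : grpalg CL, xi ^+ p = 0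
    & Z = a1 xi \/ Z = a2 xi.
  move=> _ /mapP[Z Zl ->]; have [|xi xip ZE] := lE Z; first by rewrite inE Zl orbT.
  exists (bc j xi); first by rewrite -bcX xip bc0.
  by rewrite a1E a2E; case: ZE => ->; [left|right].
have [xi xip XiE] := lE Xi (mem_head _ _).
have abL : abelian_scheme CL by exact: bc_abelian.
case: XiE => XiE.
  exists (j \o iota), CL, (bc j u + tofrac 'X *: bc j xi), (bc j v).
  split; [by split|exact: flat_nilpotent_pencil|exact: fvL| |exact: lL].
  rewrite -/(a1 _) -/(a2 _) a1L !a1E a2E /rat_pencil XE XiE map_mxD.
  by rewrite addrAC.
exists (j \o iota), CL, (bc j u), (bc j v + tofrac 'X *: bc j xi).
split; [by split|exact: fuL|exact: flat_nilpotent_pencil| |exact: lL].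
rewrite -/(a1 _) -/(a2 _) a2L !a2E a1E /rat_pencil XE XiE map_mxD.
by rewrite addrA.
Qed.

Variables (a b : 'I_p -> nat).
Hypothesis Ma : forall (K : fieldType) (iota : {rmorphism k -> K}) (alpha : pi_point p iota G),
  has_jordan_type (fd_restr (pi_map alpha) (fd_base_change iota M)) a.
Hypothesis Nb : forall (K : fieldType) (iota : {rmorphism k -> K}) (alpha : pi_point p iota G),
  has_jordan_type (fd_restr (pi_map alpha) (fd_base_change iota N)) b.

Let p_gt1 : (1 < p)%N := prime_gt1 (pcharf_prime pk).
Let p_gt0 : (0 < p)%N := ltnW p_gt1.

(** The model over [k] to which every [u (x) 1 + 1 (x) v] will be compared. *)
Definition tens_jordan :=
  fd_act (jordan_module k a) ('qX : truncpoly k p) *t 1%:M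
  + 1%:M *t fd_act (jordan_module k b) ('qX : truncpoly k p).

Lemma jordan_module_nil (c : 'I_p -> nat) :
  fd_act (jordan_module k c) ('qX : truncpoly k p) ^+ p = 0.
Proof. by rewrite -fd_actX qXp0 // linear0. Qed.

Lemma tens_jordan_nil : tens_jordan ^+ p = 0.
Proof.
have e := @exprD_pchar_comm k p _ _ _ 1 pk; rewrite expn1 in e.
rewrite /tens_jordan e.
  by rewrite !tensX !jordan_module_nil tens0mx tensmx0 addr0.
by rewrite /GRing.comm -!mulmx_ring !tensmx_mul !mulmx1 !mul1mx.
Qed.

Lemma rank_tens_jordan (K : fieldType) (iota : {rmorphism k -> K}) m n
    (X : 'M[K]_m) (Y : 'M[K]_n) :
  X ^+ p = 0 -> Y ^+ p = 0 ->
  (forall j, \rank (X ^+ j) = jordan_rank a j) ->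
  (forall j, \rank (Y ^+ j) = jordan_rank b j) ->
  forall j, \rank ((X *t 1%:M + 1%:M *t Y) ^+ j) = \rank (tens_jordan ^+ j).
Proof.
move=> Xp Yp rX rY j.
have sim c d (Z : 'M[K]_d) : Z ^+ p = 0 -> (forall j, \rank (Z ^+ j) = jordan_rank c j) ->
    let J := map_mx iota (fd_act (jordan_module k c) ('qX : truncpoly k p)) in
    exists (P : 'M_(_, d)) (Q : 'M_(d, _)),
      [/\ Q *m P = 1%:M, P *m Q = 1%:M & P *m Z = J *m P].
  move=> Zp rZ J; apply: (nilpotent_similar Zp).
    by rewrite -map_mxX jordan_module_nil map_mx0.
  by move=> i; rewrite rZ -map_mxX mxrank_map rank_jordan_module.
have [P [Q [QP PQ PX]]] := sim a m X Xp rX.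
have [P' [Q' [QP' PQ' PY]]] := sim b n Y Yp rY.
rewrite -(mxrank_map iota) map_mxX map_mxD !map_mxT !map_mx1.
apply: (@rank_similarX _ _ _ (P *t P') (Q *t Q')).
- by rewrite tensmx_mul QP QP' tens1.
- by rewrite tensmx_mul PQ PQ' tens1.
by rewrite mulmxDr mulmxDl !tensmx_mul !mulmx1 !mul1mx PX PY.
Qed.

Lemma tensor_family_rank (K : fieldType) (X : 'M[K]_(fd_dim M * fd_dim N)) l :
  tensor_family K X l -> forall j, \rank (X ^+ j) = \rank (tens_jordan ^+ j).
Proof.
move=> [iota [C [u [v /= [[ab uni] fu fv -> _]]]]].
have nil (P : fdmod (grpalg G)) (w : grpalg C) : flat_nilpotent p w ->
    fd_act (sub_mod C (fd_base_change iota P)) w ^+ p = 0.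
  by case=> wp _; rewrite -fd_actX wp linear0.
apply: (rank_tens_jordan iota).
- exact: nil M u fu.
- exact: nil N v fv.
- exact: restr_rank Ma ab uni fu.
- exact: restr_rank Nb ab uni fv.
Qed.

(** A [pi]-point only sees the subgroup [C], and the coproduct of [kG] restricts to
    that of [kC]: the tensor product may be computed over [C]. *)
Lemma base_change_tens (K : fieldType) (iota : {rmorphism k -> K})
    (C : subgroupScheme (base_change iota G)) (f : grpalg C) :
  fd_act (fd_base_change iota (fd_tens M N)) (sub_incl f)
  = tens_act (sub_mod C (fd_base_change iota M)) (sub_mod C (fd_base_change iota N)) f.
Proof.
pose m (i : 'I_(gs_order G)) := map_mx iota (fd_act M (grpalg_basis i)).
pose n (i : 'I_(gs_order G)) := map_mx iota (fd_act N (grpalg_basis i)).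
have res (P : fdmod (grpalg G)) (c : 'I_(gs_order C)) :
    fd_act (sub_mod C (fd_base_change iota P)) (grpalg_basis c)
    = \sum_(i < gs_order G) sub_res C i c *: map_mx iota (fd_act P (grpalg_basis i)).
  rewrite /= /bcmod_act; apply: eq_bigr => i _; congr (_ *: _).
  rewrite sub_inclE (bigD1 c) //= big1 ?addr0 => [|d ne]; first by rewrite mxE !eqxx mul1r.
  by rewrite mxE (negPf ne) andbF mul0r.
transitivity (\sum_(i < gs_order G) \sum_(j < gs_order G)
    grpalg_comul (G := base_change iota G) (sub_incl f) i j *: (m i *t n j)).
  rewrite /= /bcmod_act.
  transitivity (\sum_(l < gs_order G) \sum_(i < gs_order G) \sum_(j < gs_order G)
      (sub_incl f 0 l * iota (gs_mul G i j l)) *: (m i *t n j)).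
    apply: eq_bigr => l _; rewrite /= /tens_act raddf_sum scaler_sumr.
    apply: eq_bigr => i _; rewrite /= raddf_sum scaler_sumr; apply: eq_bigr => j _.
    rewrite /= map_mxZ map_mxT scalerA; congr (_ * iota _ *: _).
    rewrite /grpalg_comul (bigD1 l) //= big1 ?addr0 => [|d ne].
      by rewrite mxE !eqxx mulr1.
    by rewrite mxE (negPf ne) andbF mulr0.
  rewrite exchange_big; apply: eq_bigr => i _ /=.
  rewrite exchange_big; apply: eq_bigr => j _ /=.
  rewrite -scaler_suml /grpalg_comul; congr (_ *: _); apply: eq_bigr => l _.
  exact: mulrC.
transitivity (\sum_(i < gs_order G) \sum_(j < gs_order G) \sum_c \sum_d
    (grpalg_comul f c d * (sub_res C i c * sub_res C j d)) *: (m i *t n j)).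
  apply: eq_bigr => i _; apply: eq_bigr => j _; rewrite sub_incl_comul scaler_suml.
  apply: eq_bigr => c _; rewrite scaler_suml; apply: eq_bigr => d _.
  by rewrite mulrC.
transitivity (\sum_c \sum_d grpalg_comul f c d *:
    ((\sum_(i < gs_order G) sub_res C i c *: m i)
      *t (\sum_(i < gs_order G) sub_res C i d *: n i))); last first.
  by apply: eq_bigr => c _; apply: eq_bigr => d _; rewrite (res M c) (res N d).
under eq_bigr do rewrite exchange_big /=.
rewrite exchange_big; apply: eq_bigr => c _ /=.
under eq_bigr do rewrite exchange_big /=.
rewrite exchange_big; apply: eq_bigr => d _ /=.
rewrite tens_suml scaler_sumr; apply: eq_bigr => i _.
rewrite tens_sumr scaler_sumr; apply: eq_bigr => j _.
by rewrite tensZl tensZr !scalerA mulrA.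
Qed.

(** After the Frobenius twist [Delta u] differs from [u (x) 1 + 1 (x) u] by
    nilpotent multiples of [p]-nilpotent elements of the two factors. *)
Lemma rank_tens_point (K : fieldType) (iota : {rmorphism k -> K})
    (C : subgroupScheme (base_change iota G)) (u : grpalg C) :
  abelian_scheme C -> unipotent_scheme C -> flat_nilpotent p u ->
  forall j, \rank (fd_act (fd_base_change iota (fd_tens M N)) (sub_incl u) ^+ j)
    = \rank (tens_jordan ^+ j).
Proof.
move=> ab uni fu j; have pK : p \in [pchar K] by exact: rmorph_pchar iota _ pk.
pose phi : {rmorphism K -> K} := pFrobenius_aut pK.
pose CL := bcsub phi C.
have abL : abelian_scheme CL by exact: bc_abelian.
have uniL : unipotent_scheme CL by apply: bc_unipotent => //; exact: unipotent_nil.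
have [xi [b1 [b2 [xip b1n b2n uE]]]] := comul_frobenius_twist pK ab uni fu.1.
pose MC := sub_mod CL (fd_base_change (phi \o iota) M).
pose NC := sub_mod CL (fd_base_change (phi \o iota) N).
pose uL : grpalg CL := bc phi u.
pose act1 (x : grpalg CL) : 'M[K]_(fd_dim M * fd_dim N) := fd_act MC x *t 1%:M.
pose act2 (x : grpalg CL) : 'M[K]_(fd_dim M * fd_dim N) := 1%:M *t fd_act NC x.
have prod12 x y : act1 x * act2 y = fd_act MC x *t fd_act NC y.
  by rewrite /act1 /act2 -mulmx_ring tensmx_mul mulmx1 mul1mx.
have c12 x y : GRing.comm (act1 x) (act2 y).
  by rewrite /GRing.comm -!mulmx_ring !tensmx_mul !mulmx1 !mul1mx.
have fdC (P : fdmod (grpalg CL)) x y : fd_act P x *m fd_act P y = fd_act P y *m fd_act P x.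
  by rewrite -!fd_mul grpalg_comm.
have c11 x y : GRing.comm (act1 x) (act1 y).
  by rewrite /GRing.comm -!mulmx_ring !tensmx_mul (fdC MC).
have c22 x y : GRing.comm (act2 x) (act2 y).
  by rewrite /GRing.comm -!mulmx_ring !tensmx_mul (fdC NC).
pose l := [seq (act1 (xi i), act2 (b1 i)) | i <- index_enum 'I_(gs_order C)]
  ++ [seq (act2 (xi i), act1 (b2 i)) | i <- index_enum 'I_(gs_order C)].
have actE : fd_act (fd_base_change (phi \o iota) (fd_tens M N)) (sub_incl uL)
    = act1 uL + act2 uL + \sum_(w <- l) w.1 * w.2.
  rewrite base_change_tens big_cat !big_map /=.
  have t1 : act1 uL = \sum_i \sum_i' (uL 0 i * gs_counit CL i') *:
      (fd_act MC (grpalg_basis i) *t fd_act NC (grpalg_basis i')).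
    rewrite /act1 -(fd_one NC) -(tens_act_prod MC NC uL 1).
    by apply: eq_bigr => i _; apply: eq_bigr => i' _; rewrite grpalg_oneE.
  have t2 : act2 uL = \sum_i \sum_i' (gs_counit CL i * uL 0 i') *:
      (fd_act MC (grpalg_basis i) *t fd_act NC (grpalg_basis i')).
    rewrite /act2 -(fd_one MC) -(tens_act_prod MC NC 1 uL).
    by apply: eq_bigr => i _; apply: eq_bigr => i' _; rewrite grpalg_oneE.
  have t3 : \sum_i act1 (xi i) * act2 (b1 i) + \sum_i act2 (xi i) * act1 (b2 i)
      = \sum_i \sum_i' (\sum_m (xi m 0 i * b1 m 0 i' + b2 m 0 i * xi m 0 i')) *:
      (fd_act MC (grpalg_basis i) *t fd_act NC (grpalg_basis i')).
    rewrite -big_split /=.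
    transitivity (\sum_m \sum_i \sum_i' (xi m 0 i * b1 m 0 i' + b2 m 0 i * xi m 0 i') *:
        (fd_act MC (grpalg_basis i) *t fd_act NC (grpalg_basis i'))).
      apply: eq_bigr => m _; rewrite -c12 !prod12.
      rewrite -(tens_act_prod MC NC (xi m) (b1 m)) -(tens_act_prod MC NC (b2 m) (xi m)).
      rewrite -big_split; apply: eq_bigr => i _; rewrite -big_split.
      by apply: eq_bigr => i' _; rewrite [RHS]scalerDl.
    rewrite exchange_big; apply: eq_bigr => i _ /=.
    rewrite exchange_big; apply: eq_bigr => i' _ /=.
    by rewrite -scaler_suml.
  rewrite t1 t2 t3 /tens_act -!big_split; apply: eq_bigr => i _ /=.
  rewrite -!big_split; apply: eq_bigr => i' _ /=.
  by rewrite -!scalerDl; congr (_ *: _); exact: uE.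
have twist : \rank (fd_act (fd_base_change iota (fd_tens M N)) (sub_incl u) ^+ j)
    = \rank (fd_act (fd_base_change (phi \o iota) (fd_tens M N)) (sub_incl uL) ^+ j).
  have <- : map_mx phi (fd_act (fd_base_change iota (fd_tens M N)) (sub_incl u))
      = fd_act (fd_base_change (phi \o iota) (fd_tens M N)) (sub_incl uL).
    rewrite /uL bcsub_incl.
    exact: (esym (bcmod_act_bc phi (fd_tens M N) (sub_incl u))).
  by rewrite -map_mxX mxrank_map.
rewrite twist actE.
apply: (@rank_class_nilpotent p _ (fun j => \rank (tens_jordan ^+ j)) tensor_family) => //.
- exact: tensor_family_rank.
- move=> F X Xi s [io [D [x [y /= [abu fx fy XE sE]]]]].
  exists io, D, x, y; split=> // Z Zs; apply: sE; by rewrite inE Zs orbT.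
- exact: tensor_family_pencil.
- have fuL : flat_nilpotent (C := CL) p uL by exact: flat_nilpotent_bc.
  exists (phi \o iota), CL, uL, uL; split=> // Z.
  rewrite /unzip1 map_cat -!map_comp mem_cat => /orP[] /mapP[i _ ->];
    exists (xi i) => //; [by left|by right].
- pose good (Z : 'M[K]_(fd_dim M * fd_dim N)) :=
    (exists x, Z = act1 x) \/ (exists x, Z = act2 x).
  have cg Y Z : good Y -> good Z -> GRing.comm Y Z.
    by move=> [[x ->]|[x ->]] [[y ->]|[y ->]] //; exact/commr_sym/c12.
  have gl Z : Z \in unzip1 l ++ unzip2 l -> good Z.
    rewrite /unzip1 /unzip2 /l !map_cat -!map_comp !mem_cat -!orbA.
    by case/or4P => /mapP[i _ ->]; [left|right|right|left]; eexists.
  have gX Z : good Z -> GRing.comm Z (act1 uL + act2 uL).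
    by move=> gZ; apply: commrD; apply: cg => //; [left|right]; exists uL.
  move=> Y Z; rewrite !inE => /orP[/eqP->|/gl gY] /orP[/eqP->|/gl gZ] //.
  + exact/commr_sym/gX.
  + exact: gX.
  + exact: cg.
move=> B; rewrite /unzip2 map_cat -!map_comp mem_cat => /orP[] /mapP[i _ ->] /=.
  by have [e be] := b1n i; exists e; rewrite tensX -(fd_actX NC) be linear0 tensmx0.
by have [e be] := b2n i; exists e; rewrite tensX -(fd_actX MC) be linear0 tens0mx.
Qed.

End TensorFamily.

Theorem corollary5p3 (p : nat) (k : fieldType) (hp : p \in [pchar k])
    (G : finGroupScheme k) (M N : fdmod (grpalg G)) :
  constant_jordan_type p M -> constant_jordan_type p N ->
  constant_jordan_type p (fd_tens M N).
Proof.
move=> [a Ma] [b Nb].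
have [c rc] := nilpotent_jordan_rank (tens_jordan_nil hp a b).
exists c => K iota alpha.
have p_gt1 : (1 < p)%N := prime_gt1 (pcharf_prime hp).
have [C [u [ab uni fu e]]] := pi_point_element p_gt1 alpha.
apply/(jordan_typeP (ltnW p_gt1)) => j; rewrite -rc /= e.
exact: (rank_tens_point hp Ma Nb ab uni fu j).
Qed.
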